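(* The polymorphism clones $\mathrm{Pol}(\mathbb{Q},circ)$ and $\mathrm{Pol}(\mathbb{Q},sep)$ have automatic homeomorphicity: for each $P$ among these and every countable set $\Omega$, every clone isomorphism $\theta$ from $P$ onto a closed subclone of $\mathcal{O}_\Omega$ is a homeomorphism.
   Context: On $\mathbb{Q}$, $circ(x,y,z)$ iff $x\le y\le z$ or $y\le z\le x$ or $z\le x\le y$; $sep(x,y,z,t)$ iff ($circ(x,y,z)\wedge circ(x,t,y)$) or ($circ(x,z,y)\wedge circ(x,y,t)$). For a set $A$, $\mathcal{O}_A$ is the set of all finitary operations $A^n\to A$ ($n\ge 0$). A clone is a subset of $\mathcal{O}_A$ containing all projections and closed under composition; a clone isomorphism is a bijection preserving arities, projections and composition. $\mathrm{Pol}(\mathbb{Q},circ)$ is the clone of all $f:\mathbb{Q}^n\to\mathbb{Q}$ such that if $circ(a_i,b_i,c_i)$ for all $i$ then $circ(f(\bar a),f(\bar b),f(\bar c))$; $\mathrm{Pol}(\mathbb{Q},sep)$ is defined likewise for the quaternary relation $sep$. Clones carry the topology of pointwise convergence on each arity (the $n$-ary part with the topology induced from the product topology on $A^{A^n}$, $A$ discrete, and the clone being the topological sum of its $n$-ary parts). *)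

(* Defs.v *)
From mathcomp Require Import all_boot all_order all_algebra.
From mathcomp Require Import all_classical all_reals all_analysis.

Set Implicit Arguments.
Unset Strict Implicit.
Unset Printing Implicit Defensive.

Import Order.TTheory GRing.Theory Num.Theory.
Local Open Scope classical_set_scope.
Local Open Scope ring_scope.

(* The carrier is tagged [discrete_topology] because types such as [rat] also
   carry a canonical non-discrete (metric) topology. *)
Definition operation (A : choiceType) (n : nat) : topologicalType :=
  {ptws ('I_n -> A) -> discrete_topology A}.

Definition projection (A : choiceType) (n : nat) (i : 'I_n) : operation A n :=
  fun x => x i.
Arguments projection A {n} i.

Definition composition (A : choiceType) (n m : nat)
    (f : operation A n) (g : 'I_n -> operation A m) : operation A m :=
  fun x => f (fun i => g i x).

(* A set of finitary operations, given by its n-ary parts. *)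
Definition operations (A : choiceType) := forall n : nat, set (operation A n).

Definition is_clone (A : choiceType) (C : operations A) : Prop :=
  (forall (n : nat) (i : 'I_n), C n (projection A i)) /\
  (forall (n m : nat) (f : operation A n) (g : 'I_n -> operation A m),
     C n f -> (forall i, C m (g i)) -> C m (composition f g)).

(* The space O_A : topological sum over n of the spaces A^(A^n). *)
Definition all_operations (A : choiceType) : topologicalType :=
  {n : nat & operation A n}.

Definition closed_operations (A : choiceType) (C : operations A) : Prop :=
  closed [set f : all_operations A | C (projT1 f) (projT2 f)].

(* The topological sum of the n-ary parts, each with the topology induced from
   [operation A n]. *)
Definition clone_space (A : choiceType) (C : operations A) : topologicalType :=
  {n : nat & set_type (C n)}.

(* Arity preservation is built into the type of [theta]. *)
Definition clone_map (A B : choiceType) (C : operations A) (D : operations B)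
    (theta : forall n, set_type (C n) -> set_type (D n)) :
    clone_space C -> clone_space D :=
  fun f => existT (fun n => set_type (D n)) (projT1 f)
             (theta (projT1 f) (projT2 f)).

Definition clone_isomorphism (A B : choiceType)
    (C : operations A) (D : operations B)
    (theta : forall n, set_type (C n) -> set_type (D n)) : Prop :=
  [/\ bijective (clone_map theta),
      forall (n : nat) (i : 'I_n) (p : set_type (C n)),
        set_val p = projection A i -> set_val (theta n p) = projection B i
    & forall (n m : nat) (f : set_type (C n)) (g : 'I_n -> set_type (C m))
        (h : set_type (C m)),
        set_val h = composition (set_val f) (fun i => set_val (g i)) ->
        set_val (theta m h) =
          composition (set_val (theta n f)) (fun i => set_val (theta m (g i)))].

Definition homeomorphism (X Y : topologicalType) (f : X -> Y) : Prop :=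
  continuous f /\
  exists g : Y -> X, [/\ cancel f g, cancel g f & continuous g].

(* [countType] includes the finite types, the empty one among them. *)
Definition automatic_homeomorphicity (A : choiceType) (P : operations A) :
    Prop :=
  forall (Omega : countType) (Q : operations Omega)
    (theta : forall n, set_type (P n) -> set_type (Q n)),
    is_clone Q -> closed_operations Q -> clone_isomorphism theta ->
    homeomorphism (clone_map theta).

Definition Pol3 (A : choiceType) (R : A -> A -> A -> Prop) : operations A :=
  fun n => [set f : operation A n | forall a b c : 'I_n -> A,
    (forall i, R (a i) (b i) (c i)) -> R (f a) (f b) (f c)].

Definition Pol4 (A : choiceType) (R : A -> A -> A -> A -> Prop) :
    operations A :=
  fun n => [set f : operation A n | forall a b c d : 'I_n -> A,
    (forall i, R (a i) (b i) (c i) (d i)) -> R (f a) (f b) (f c) (f d)].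

Lemma Pol3_clone (A : choiceType) (R : A -> A -> A -> Prop) :
  is_clone (Pol3 R).
Proof.
split=> [n i a b c /(_ i)//|n m f g Cf Cg a b c Rabc].
by apply: Cf => i; apply: Cg.
Qed.

Lemma Pol4_clone (A : choiceType) (R : A -> A -> A -> A -> Prop) :
  is_clone (Pol4 R).
Proof.
split=> [n i a b c d /(_ i)//|n m f g Cf Cg a b c d Rabcd].
by apply: Cf => i; apply: Cg.
Qed.

Definition circ (x y z : rat) : Prop :=
  x <= y <= z \/ y <= z <= x \/ z <= x <= y.

Definition sep (x y z t : rat) : Prop :=
  (circ x y z /\ circ x t y) \/ (circ x z y /\ circ x y t).

(* Main.v *)
(** Every operation in these clones is two-valued or depends on a single
    coordinate: if in each coordinate two of three points agree, then [circ]
    holds for them in every order (and [sep] holds with the third repeated), so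
    their images cannot be distinct. A unary [circ]-preserving map with at least
    three values is, up to a translation, a monotone map of the circle cut at 0;
    it factors as [T \o m] with a universal [T] and an embedding [m] of the cut
    order.

    Constants belong to the clones, so they embed the rationals in [Omega] and
    the inverse of an isomorphism is continuous. For the continuity of the
    isomorphism itself, a Baire argument followed by successive approximation,
    whose limits stay in the closed target clone, shows that each point of
    [Omega] is fixed by the pointwise stabilizer of a finite set of rationals
    in the automorphism group of the cut order. Passing to limits again
    extends this to the embeddings [m], hence to all maps [T \o m]. Two-valued
    operations act on a tuple of [Omega] through a quotient of a power set; an
    automorphism fixing a finite set F and exchanging two complementary dense
    sets off F shows that the complement of F is null in that quotient. *)

Require Import Defs.
From mathcomp Require Import all_boot all_order all_algebra.
From mathcomp Require Import all_classical all_reals all_analysis.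
From mathcomp Require Import lra ring.

Set Implicit Arguments.
Unset Strict Implicit.
Unset Printing Implicit Defensive.

Import Order.TTheory GRing.Theory Num.Theory.
Local Open Scope classical_set_scope.
Local Open Scope ring_scope.

(** * Partial isomorphisms of countable orders *)

Lemma dependent_choice (S : Type) (I : nat -> S -> Prop)
    (R : nat -> S -> S -> Prop) (s0 : S) :
  I 0%N s0 ->
  (forall n s, I n s -> exists s', I n.+1 s' /\ R n s s') ->
  exists u : nat -> S,
    u 0%N = s0 /\ forall n, I n (u n) /\ R n (u n) (u n.+1).
Proof.
move=> I0 step.
have /choice[next nextP] : forall p : nat * S, exists s',
    I p.1 p.2 -> I p.1.+1 s' /\ R p.1 p.2 s'.
  move=> [n s] /=; have [Ins|nI] := pselect (I n s).
    by have [s' ?] := step n s Ins; exists s'.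
  by exists s.
pose u := nat_rect (fun=> S) s0 (fun n s => next (n, s)).
have uI n : I n (u n).
  by elim: n => [|n IH] //=; have [] := nextP (n, u n) IH.
by exists u; split=> // n; split=> //; have [] := nextP (n, u n) (uI n).
Qed.

Definition pairwise_on (Z : eqType) (R : Z -> Z -> Prop) (l : seq Z) :=
  {in l &, forall z z', R z z'}.

(** Countably many requirements [t i] are met in turn, each by adding at most one element to a
    finite list that stays pairwise compatible; [S] is the union of these lists. One-sided and
    back-and-forth constructions are both instances. *)
Lemma generic_set (Z : eqType) (R : Z -> Z -> Prop) (T : countType)
    (t : T -> Z -> Prop) (l0 : seq Z) :
  pairwise_on R l0 ->
  (forall i l, {subset l0 <= l} -> pairwise_on R l ->
     exists z, t i z /\ pairwise_on R (z :: l)) ->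
  exists S : Z -> Prop, [/\ {in l0, forall z, S z},
    forall z z', S z -> S z' -> R z z' & forall i, exists z, S z /\ t i z].
Proof.
move=> R0 ext.
pose I (n : nat) l := {subset l0 <= l} /\ pairwise_on R l.
pose Q (n : nat) (l l' : seq Z) := {subset l <= l'} /\
  forall i : T, unpickle n = Some i -> exists z, z \in l' /\ t i z.
have [|n l [sl Rl]|u [u0 uP]] := @dependent_choice _ I Q l0.
- by split.
- case E : (unpickle n) => [i|]; last first.
    by exists l; split=> //; split=> // i; rewrite E.
  have [z [tz Rz]] := ext i l sl Rl.
  exists (z :: l); split; split=> //.
  + by move=> y /sl; rewrite inE orbC => ->.
  + by move=> y; rewrite inE orbC => ->.
  + by move=> j; rewrite E => -[<-]; exists z; rewrite mem_head.
have mono m k : {subset u m <= u (m + k)%N}.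
  elim: k => [|k IH]; first by rewrite addn0.
  by move=> z /IH; rewrite addnS; have [_ [+ _]] := uP (m + k)%N; apply.
exists (fun z => exists n, z \in u n); split.
- by move=> z z0; exists 0%N; rewrite u0.
- move=> z z' [n zn] [n' zn']; have [[_ +] _] := uP (n + n')%N; apply.
    exact: mono.
  by rewrite addnC; apply: mono.
- move=> i; have [_ [_ /(_ i (pickleK i))[z [zu tz]]]] := uP (pickle i).
  by exists z; split=> //; exists (pickle i).+1.
Qed.

Definition strict_total (T : eqType) (lt : rel T) :=
  [/\ irreflexive lt, transitive lt
    & forall x y, x != y -> lt x y || lt y x].

Lemma strict_total_asym (T : eqType) (lt : rel T) :
  strict_total lt -> forall x y, lt x y -> lt y x = false.
Proof.
move=> [irr tr _] x y xy; apply/negP => yx.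
by have := tr _ _ _ xy yx; rewrite irr.
Qed.

Lemma strict_total_converse (T : eqType) (lt : rel T) :
  strict_total lt -> strict_total (fun x y => lt y x).
Proof.
move=> [irr tr tot]; split=> [x|y x z yx zy|x y xy]; first exact: irr.
- exact: tr zy yx.
- by rewrite orbC tot.
Qed.

Lemma seq_maximum (T U : eqType) (lt : rel U) (key : T -> U) (s : seq T)
    (P : pred T) :
  strict_total lt -> has P s ->
  exists2 m, (m \in s) && P m &
    {in s, forall x, P x -> (key x == key m) || lt (key x) (key m)}.
Proof.
move=> [irr tr tot]; elim: s => //= a s IH.
have [hs _|nhs] := boolP (has P s); last first.
  rewrite orbF => Pa; exists a; first by rewrite mem_head.
  move=> x; rewrite inE => /orP[/eqP->|xs Px]; first by rewrite eqxx.
  by case/negP: nhs; apply/hasP; exists x.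
have [m /andP[ms Pm] mP] := IH hs.
have [Ma|Mm] := boolP (P a && lt (key m) (key a)).
  have /andP[Pa ma] := Ma.
  exists a; first by rewrite mem_head.
  move=> x; rewrite inE => /orP[/eqP->|xs Px]; first by rewrite eqxx.
  have /orP[/eqP->|xm] := mP x xs Px; first by rewrite ma orbT.
  by rewrite (tr _ _ _ xm ma) orbT.
exists m; first by rewrite inE ms orbT.
move=> x; rewrite inE => /orP[/eqP-> Pa|]; last exact: mP.
have [//|ne] := eqVneq (key a) (key m).
by move: Mm; rewrite Pa /=; have /orP[|->] := tot _ _ ne.
Qed.

Definition same_order (X Y : eqType) (ltX : rel X) (ltY : rel Y)
  (p q : X * Y) : Prop := ltX p.1 q.1 = ltY p.2 q.2.

Section Orders.
Variables (X Y : eqType) (ltX : rel X) (ltY : rel Y).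
Hypotheses (oX : strict_total ltX) (oY : strict_total ltY).
Notation good := (pairwise_on (same_order ltX ltY)).

(** Only the nearest neighbours of [x] in the domain constrain its image. The orders used below have
    a least point, kept in the domain, so the upper neighbour alone may be missing. *)
Lemma insert_pair (l : seq (X * Y)) (x : X) :
  good l -> x \notin map fst l -> has (fun p => ltX p.1 x) l ->
  exists2 p1, (p1 \in l) && ltX p1.1 x &
    ((exists2 p2, (p2 \in l) && ltX x p2.1 &
        forall y, ltY p1.2 y -> ltY y p2.2 -> good ((x, y) :: l)) \/
     (forall y, ltY p1.2 y -> good ((x, y) :: l))).
Proof.
move=> gl xl hl; have [irrX trX totX] := oX; have [irrY trY totY] := oY.
have key p : p \in l -> ltX p.1 x || ltX x p.1.
  move=> pl; apply: totX; apply: contraNneq xl => <-.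
  by apply/mapP; exists p.
have eqk p q : p \in l -> q \in l -> p.1 == q.1 -> p.2 = q.2.
  move=> pl ql /eqP e; apply/eqP; apply: contraT => /totY.
  by rewrite -(gl _ _ pl ql) -(gl _ _ ql pl) e irrX.
have fin y : {in l, forall p, ltX p.1 x -> ltY p.2 y} ->
    {in l, forall p, ltX x p.1 -> ltY y p.2} -> good ((x, y) :: l).
  move=> lo hi p q; rewrite !inE => /orP[/eqP->|pl] /orP[/eqP->|ql].
  - by rewrite /same_order /= irrX irrY.
  - rewrite /same_order /=; have /orP[qx|xq] := key q ql.
      by rewrite (strict_total_asym oX qx) (strict_total_asym oY (lo _ ql qx)).
    by rewrite xq (hi _ ql xq).
  - rewrite /same_order /=; have /orP[px|xp] := key p pl.
      by rewrite px (lo _ pl px).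
    by rewrite (strict_total_asym oX xp) (strict_total_asym oY (hi _ pl xp)).
  - exact: gl.
have [p1 /andP[p1l p1x] max1] := seq_maximum fst oX hl.
exists p1; first by rewrite p1l.
have lo y : ltY p1.2 y -> {in l, forall p, ltX p.1 x -> ltY p.2 y}.
  move=> p1y p pl px; have /orP[/(eqk _ _ pl p1l)->//|pp1] := max1 p pl px.
  by apply: trY p1y; rewrite -(gl _ _ pl p1l).
have [hu|nhu] := boolP (has (fun p => ltX x p.1) l).
  have [p2 /andP[p2l xp2] min2] :=
    seq_maximum fst (strict_total_converse oX) hu.
  left; exists p2; first by rewrite p2l.
  move=> y p1y yp2; apply: fin => [|p pl xp]; first exact: lo.
  have /orP[/(eqk _ _ pl p2l)->//|pp2] := min2 p pl xp.
  by apply: trY yp2 _; rewrite -(gl _ _ p2l pl).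
right=> y p1y; apply: fin => [|p pl xp]; first exact: lo.
by case/negP: nhu; apply/hasP; exists p.
Qed.

(** Density and cofinality, the conditions suited to orders with a least point, where no insertion
    takes place at the bottom. *)
Definition rich (P : Y -> Prop) :=
  (forall a b, ltY a b -> exists y, [/\ ltY a y, ltY y b & P y]) /\
  (forall a, exists y, ltY a y /\ P y).

Lemma insert_rich (P : Y -> Prop) (l : seq (X * Y)) (x : X) :
  rich P -> good l -> x \notin map fst l -> has (fun p => ltX p.1 x) l ->
  exists y, P y /\ good ((x, y) :: l).
Proof.
move=> [dP uP] gl xl hl.
have [p1 /andP[p1l p1x] [[p2 /andP[p2l xp2] ins]|ins]] := insert_pair gl xl hl.
  have [|y [p1y yp2 Py]] := dP p1.2 p2.2.
    by rewrite -(gl _ _ p1l p2l); have [_ tr _] := oX; apply: tr xp2.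
  by exists y; split=> //; apply: ins.
by have [y [p1y Py]] := uP p1.2; exists y; split=> //; apply: ins.
Qed.

End Orders.

Lemma pairwise_on_swap (X Y : eqType) (ltX : rel X) (ltY : rel Y) l :
  pairwise_on (same_order ltX ltY) l ->
  pairwise_on (same_order ltY ltX) (map (fun p => (p.2, p.1)) l).
Proof.
by move=> gl _ _ /mapP[p pl ->] /mapP[q ql ->]; symmetry; apply: gl.
Qed.

(** The forth half of Cantor's argument, under a side condition [C] on each point and its image. *)
Lemma embedding_extension (X : countType) (Y : eqType) (ltX : rel X)
    (ltY : rel Y) (C : X -> Y -> Prop) (l0 : seq (X * Y)) :
  strict_total ltX -> strict_total ltY ->
  pairwise_on (same_order ltX ltY) l0 -> {in l0, forall p, C p.1 p.2} ->
  (forall x l, {subset l0 <= l} -> pairwise_on (same_order ltX ltY) l ->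
     {in l, forall p, C p.1 p.2} -> x \notin map fst l ->
     exists y, C x y /\ pairwise_on (same_order ltX ltY) ((x, y) :: l)) ->
  exists f : X -> Y, [/\ forall x x', ltX x x' = ltY (f x) (f x'),
    forall x, C x (f x) & {in l0, forall p, f p.1 = p.2}].
Proof.
move=> oX oY g0 C0 ext.
pose R p q := same_order ltX ltY p q /\ C p.1 p.2.
have [|x l l0l Rl|S [S0 SR St]] :=
    @generic_set _ R X (fun x p => p.1 = x) l0.
- by move=> p q pl ql; split; [apply: g0|apply: C0].
- have gl : pairwise_on (same_order ltX ltY) l.
    by move=> p q pl ql; have [] := Rl p q pl ql.
  have Cl : {in l, forall p, C p.1 p.2}.
    by move=> p pl; have [] := Rl p p pl pl.
  have [/mapP[p pl ->]|xl] := boolP (x \in map fst l).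
    exists p; split=> // q q'; rewrite !inE.
    by move=> /orP[/eqP->|ql] /orP[/eqP->|q'l]; apply: Rl.
  have [y [Cxy gy]] := ext x l l0l gl Cl xl.
  exists (x, y); split=> // p q pl ql; split; first exact: gy.
  by move: pl; rewrite inE => /orP[/eqP->//|/Cl].
have /choice[f fP] : forall x, exists y, S (x, y).
  by move=> x; have [[x' y] [? /= e]] := St x; exists y; rewrite -e.
exists f; split=> [x x'|x|p pl].
- by have [] := SR _ _ (fP x) (fP x').
- by have [] := SR _ _ (fP x) (fP x).
- have [irrX _ _] := oX; have [_ _ totY] := oY.
  have [] := SR _ _ (fP p.1) (S0 _ pl); have [] := SR _ _ (S0 _ pl) (fP p.1).
  rewrite /same_order /= irrX => e1 _ e2 _.
  by apply/eqP; apply: contraT => /totY; rewrite -e1 -e2.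
Qed.

(** Cantor's back-and-forth: the requirements are indexed by a disjoint sum, a left index asking for
    an image and a right one for a preimage. *)
Lemma isomorphism_extension (X Y : countType) (ltX : rel X)
    (ltY : rel Y) (C : X -> Y -> Prop) (l0 : seq (X * Y)) :
  strict_total ltX -> strict_total ltY ->
  pairwise_on (same_order ltX ltY) l0 -> {in l0, forall p, C p.1 p.2} ->
  (forall x l, {subset l0 <= l} -> pairwise_on (same_order ltX ltY) l ->
     x \notin map fst l ->
     exists y, C x y /\ pairwise_on (same_order ltX ltY) ((x, y) :: l)) ->
  (forall y l, {subset l0 <= l} -> pairwise_on (same_order ltX ltY) l ->
     y \notin map snd l ->
     exists x, C x y /\ pairwise_on (same_order ltX ltY) ((x, y) :: l)) ->
  exists (f : X -> Y) (g : Y -> X), [/\ cancel f g, cancel g f,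
    forall x x', ltX x x' = ltY (f x) (f x'),
    forall x, C x (f x) & {in l0, forall p, f p.1 = p.2}].
Proof.
move=> oX oY g0 C0 forth back.
pose R p q := same_order ltX ltY p q /\ C p.1 p.2.
pose t (i : X + Y) (p : X * Y) :=
  match i with inl x => p.1 = x | inr y => p.2 = y end.
have [|i l l0l Rl|S [S0 SR St]] := @generic_set _ R (X + Y)%type t l0.
- by move=> p q pl ql; split; [apply: g0|apply: C0].
- have gl : pairwise_on (same_order ltX ltY) l.
    by move=> p q pl ql; have [] := Rl p q pl ql.
  have Cl : {in l, forall p, C p.1 p.2}.
    by move=> p pl; have [] := Rl p p pl pl.
  have old p : p \in l -> pairwise_on R (p :: l).
    move=> pl q q'; rewrite !inE.
    by move=> /orP[/eqP->|ql] /orP[/eqP->|q'l]; apply: Rl.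
  have new x y : C x y -> pairwise_on (same_order ltX ltY) ((x, y) :: l) ->
      pairwise_on R ((x, y) :: l).
    move=> Cxy gy p q pl ql; split; first exact: gy.
    by move: pl; rewrite inE => /orP[/eqP->//|/Cl].
  case: i => [x|y] /=.
    have [/mapP[p pl ->]|xl] := boolP (x \in map fst l).
      by exists p; split=> //; apply: old.
    have [y [Cxy gy]] := forth x l l0l gl xl.
    by exists (x, y); split=> //; apply: new.
  have [/mapP[p pl ->]|yl] := boolP (y \in map snd l).
    by exists p; split=> //; apply: old.
  have [x [Cxy gx]] := back y l l0l gl yl.
  by exists (x, y); split=> //; apply: new.
have /choice[f fP] : forall x, exists y, S (x, y).
  by move=> x; have [[x' y] [? /= e]] := St (inl x); exists y; rewrite -e.
have /choice[g gP] : forall y, exists x, S (x, y).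
  by move=> y; have [[x y'] [? /= e]] := St (inr y); exists x; rewrite -e.
have [irrX _ totX] := oX; have [irrY _ totY] := oY.
have fun1 x y y' : S (x, y) -> S (x, y') -> y = y'.
  move=> s s'; have [e1 _] := SR _ _ s s'; have [e2 _] := SR _ _ s' s.
  move: e1 e2; rewrite /same_order /= irrX => e1 e2.
  by apply/eqP; apply: contraT => /totY; rewrite -e1 -e2.
have inj1 x x' y : S (x, y) -> S (x', y) -> x = x'.
  move=> s s'; have [e1 _] := SR _ _ s s'; have [e2 _] := SR _ _ s' s.
  move: e1 e2; rewrite /same_order /= irrY => e1 e2.
  by apply/eqP; apply: contraT => /totX; rewrite e1 e2.
exists f, g; split=> [x|y|x x'|x|[x y] pl].
- exact: inj1 (gP _) (fP _).
- exact: fun1 (fP _) (gP _).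
- by have [] := SR _ _ (fP x) (fP x').
- by have [] := SR _ _ (fP x) (fP x).
- exact: fun1 (fP _) (S0 _ pl).
Qed.

(** * The order obtained by cutting the circle at 0 *)

(** The nonnegative rationals come first and the negative ones after them, each in the usual order.
    Thus 0 is the least point, and going up means going once around the circle. *)
Definition ltc (x y : rat) : bool :=
  if (x < 0) == (y < 0) then x < y else y < 0.

Definition lec (x y : rat) : bool := (x == y) || ltc x y.

Lemma lecE x y : lec x y = if (x < 0) == (y < 0) then x <= y else y < 0.
Proof.
rewrite /lec /ltc; have [->|ne] := eqVneq x y; first by rewrite eqxx lexx.
by rewrite le_eqVlt (negPf ne).
Qed.

Lemma ltc_strict_total : strict_total ltc.
Proof.
split=> [x|y x z|x y /eqP ne]; rewrite /ltc.
- by rewrite eqxx ltxx.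
- by case: (ltrP x 0); case: (ltrP y 0); case: (ltrP z 0) => hz hy hx //=; lra.
- case: (ltrP x 0); case: (ltrP y 0) => hy hx //=; apply/orP; lra.
Qed.

Lemma ltc_trans : transitive ltc. Proof. by case: ltc_strict_total. Qed.

Lemma ltc_irr x : ltc x x = false.
Proof. by case: ltc_strict_total => ->. Qed.

Lemma ltc0 x : ltc 0 x = (x != 0).
Proof. by rewrite /ltc ltxx; case: (ltgtP x 0). Qed.

Lemma ltc_0 x : ltc x 0 = false.
Proof. by rewrite /ltc ltxx; case: (ltgtP x 0). Qed.

Lemma lec0 x : lec 0 x.
Proof. by rewrite /lec ltc0 eq_sym; case: eqP. Qed.

Lemma lec_0 x : lec x 0 = (x == 0).
Proof. by rewrite /lec ltc_0 orbF. Qed.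

Lemma lecxx x : lec x x. Proof. by rewrite /lec eqxx. Qed.

Lemma lecNlt x y : lec x y = ~~ ltc y x.
Proof.
have [irr tr tot] := ltc_strict_total; rewrite /lec.
have [->|/tot/orP[xy|yx]] := eqVneq x y; first by rewrite irr.
  by rewrite xy (strict_total_asym ltc_strict_total xy).
by rewrite yx (strict_total_asym ltc_strict_total yx).
Qed.

Lemma lec_trans : transitive lec.
Proof.
move=> y x z /orP[/eqP->//|xy] /orP[/eqP<-|yz]; rewrite /lec ?xy ?orbT //.
by rewrite (ltc_trans xy yz) orbT.
Qed.

Lemma lec_anti x y : lec x y -> lec y x -> x = y.
Proof.
move=> /orP[/eqP//|xy] /orP[/eqP//|yx].
by have := ltc_trans xy yx; rewrite ltc_irr.
Qed.

Lemma ltcW x y : ltc x y -> lec x y.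
Proof. by rewrite /lec => ->; rewrite orbT. Qed.

Lemma lec_total x y : lec x y || lec y x.
Proof.
rewrite !lecNlt; case E : (ltc y x) => //=.
by rewrite (strict_total_asym ltc_strict_total E).
Qed.

Lemma circ_rot x y z : circ x y z -> circ y z x.
Proof. by rewrite /circ; tauto. Qed.

Lemma circ_lec x y z : lec x y -> lec y z -> circ x y z.
Proof.
rewrite !lecE /circ.
case: (ltrP x 0); case: (ltrP y 0); case: (ltrP z 0) => hz hy hx //= h1 h2;
  solve [left; lra|right; left; lra|right; right; lra].
Qed.

(** A circular order is the cyclic closure of the linear order obtained by cutting it at any point;
    here the cut is moved to 0. *)
Lemma circP x y z : circ x y z <->
  [\/ lec x y && lec y z, lec y z && lec z x | lec z x && lec x y].
Proof.
split=> [|[] /andP[]]; last 3 first.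
- exact: circ_lec.
- by move=> yz zx; do 2 apply: circ_rot; apply: circ_lec.
- by move=> zx xy; apply: circ_rot; apply: circ_lec.
suff H a b c : a <= b <= c ->
    [|| lec a b && lec b c, lec b c && lec c a | lec c a && lec a b].
  by move=> [/H|[/H|/H]] /or3P[] h;
    solve [constructor 1; exact h|constructor 2; exact h
      |constructor 3; exact h].
move=> /andP[ab bc]; rewrite !lecE.
case: (ltrP a 0); case: (ltrP b 0); case: (ltrP c 0) => hc hb ha //=;
  rewrite ?ab ?bc ?orbT //; lra.
Qed.

Lemma circ_xx x y : circ x x y.
Proof.
by have /orP[h|h] := le_total x y; [left|right; right]; rewrite lexx h.
Qed.

Lemma circ0 a b : circ 0 a b -> b != 0 -> lec a b.
Proof.
rewrite circP !lec_0 lec0 /= => [[//|/andP[_ ->//]|]].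
by rewrite andbT => ->.
Qed.

Lemma circ_anti a b c : circ a b c -> circ a c b -> [\/ a = b, b = c | a = c].
Proof.
rewrite /circ => h1 h2.
have [->|ab] := eqVneq a b; first by constructor 1.
have [->|bc] := eqVneq b c; first by constructor 2.
constructor 3; move/eqP in ab; move/eqP in bc.
by move: h1 h2 => [/andP[]|[/andP[]|/andP[]]] ? ? [/andP[]|[/andP[]|/andP[]]];
  lra.
Qed.

Lemma circ_total a b c : circ a b c \/ circ a c b.
Proof.
rewrite /circ; have [|] := lerP a b; have [|] := lerP b c;
  have [|] := lerP a c => /= *; solve [left; left; lra|left; right; left; lra
    |left; right; right; lra|right; left; lra|right; right; left; lra
    |right; right; right; lra].
Qed.

Definition mono0 (m : rat -> rat) := forall x y, ltc x y -> ltc (m x) (m y).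

(** The inverse is part of the data, so that successive approximations can control it together with
    the map. *)
Definition automorphism (g g' : rat -> rat) :=
  [/\ cancel g g', cancel g' g & mono0 g].

Lemma mono0_lec m : mono0 m -> forall x y, lec x y -> lec (m x) (m y).
Proof. by move=> mm x y /orP[/eqP->|/mm]; [exact: lecxx|exact: ltcW]. Qed.

Lemma mono0_lt m : mono0 m -> forall x y, ltc (m x) (m y) = ltc x y.
Proof.
move=> mm x y; apply/idP/idP; last exact: mm.
by move=> h; rewrite -[ltc x y]negbK -lecNlt; apply/negP => /(mono0_lec mm);
  rewrite lecNlt h.
Qed.

Lemma automorphism_inv g g' : automorphism g g' -> automorphism g' g.
Proof.
by move=> [gK g'K mg]; split=> // x y xy; rewrite -(mono0_lt mg) !g'K.
Qed.

Lemma automorphism_comp g g' h h' : automorphism g g' -> automorphism h h' ->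
  automorphism (g \o h) (h' \o g').
Proof.
move=> [gK g'K mg] [hK h'K mh]; split.
- exact: can_comp.
- exact: can_comp.
- by move=> x y /mh /mg.
Qed.

Lemma automorphism_id : automorphism id id.
Proof. by split. Qed.

(* Fractions with odd denominator form a dense subgroup of the rationals that
   omits 1/2, so both the subgroup and its complement are dense. *)
Definition odd_fraction (x : rat) : bool :=
  `[< exists (a : int) (n : nat), odd n /\ x = a%:~R / n%:R >].

Lemma odd_fraction_dense_lt (x y : rat) : x < y ->
  exists z, [/\ x < z, z < y & odd_fraction z].
Proof.
(* An odd denominator exceeding [1 / (y - x)], so that some multiple of [1 / N] falls strictly
   between. *)
move=> xy; pose N := (2 * Num.Def.archi_bound (y - x)^-1).+1.
have N0 : 0 < N%:R :> rat by rewrite ltr0n.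
have big : 1 < N%:R * (y - x).
  have d0 : 0 < y - x by rewrite subr_gt0.
  rewrite -ltr_pdivrMr// div1r; apply: lt_trans (archi_boundP _) _.
    by rewrite invr_ge0 ltW.
  by rewrite ltr_nat /N ltnS leq_pmull.
pose a := Num.floor (N%:R * x) + 1.
have l1 : N%:R * x < a%:~R by rewrite floorD1_gt.
have l2 : a%:~R <= N%:R * x + 1 by rewrite intrD lerD2r floor_le.
exists (a%:~R / N%:R); split.
- by rewrite ltr_pdivlMr// mulrC.
- rewrite ltr_pdivrMr// mulrC; lra.
- by apply/asboolP; exists a, N; split=> //; rewrite /N oddS oddM.
Qed.

Lemma color_dense_lt (c : bool) (x y : rat) : x < y ->
  exists z, [/\ x < z, z < y & odd_fraction z = c].
Proof.
case: c => [|xy]; first exact: odd_fraction_dense_lt.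
(* A point off the subgroup is a member of it shifted by 1/2. *)
have [|z [xz zy /asboolP[a [n [on ez]]]]] :=
  @odd_fraction_dense_lt (x - 1 / 2) (y - 1 / 2); first lra.
exists (z + 1 / 2); split; [lra|lra|].
apply/negP => /asboolP[b [m [om em]]].
have n0 : n%:R != 0 :> rat by rewrite pnatr_eq0; case: n on {ez}.
have m0 : m%:R != 0 :> rat by rewrite pnatr_eq0; case: m om {em}.
(* If both [z] and [z + 1 / 2] had odd denominators, clearing them would make the odd number [n * m]
   even. *)
have : (n * m)%:Z = 2 * (b * n%:Z - a * m%:Z).
  apply: (@intr_inj rat); rewrite !(intrM, intrB, PoszM) -!pmulrn.
  have -> : b%:~R = (z + 1 / 2) * m%:R :> rat by rewrite em divfK.
  have -> : a%:~R = z * n%:R :> rat by rewrite ez divfK.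
  by field.
move=> /(congr1 absz); rewrite abszM /= => /(congr1 odd).
by rewrite oddM on om /= mul2n odd_double.
Qed.

Lemma color_rich (c : bool) : rich ltc (fun z => odd_fraction z = c).
Proof.
split=> [a b|a]; rewrite /ltc.
  case: (ltrP a 0); case: (ltrP b 0) => hb ha //= ab.
  - have [z [az zb cz]] := color_dense_lt c ab.
    have hz : z < 0 by lra.
    by exists z; rewrite hz az zb.
  (* Every rational above a nonnegative [a] still precedes the negative [b] in the cut order. *)
  - have [|z [az _ cz]] := @color_dense_lt c a (a + 1); first lra.
    have hz : (z < 0) = false by apply/negbTE; rewrite -leNgt; lra.
    by exists z; rewrite hz az.
  - have [z [az zb cz]] := color_dense_lt c ab.
    have hz : (z < 0) = false by apply/negbTE; rewrite -leNgt; lra.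
    by exists z; rewrite hz az zb.
have [ha|ha] := ltrP a 0.
  have [z [az zb cz]] := color_dense_lt c ha.
  by exists z; rewrite zb az.
have [|z [_ zb cz]] := @color_dense_lt c (-1) 0; first lra.
by exists z; rewrite zb.
Qed.

Lemma insert_rich_back (X Y : eqType) (ltX : rel X) (ltY : rel Y)
    (P : X -> Prop) (l : seq (X * Y)) (y : Y) :
  strict_total ltX -> strict_total ltY -> rich ltX P ->
  pairwise_on (same_order ltX ltY) l -> y \notin map snd l ->
  has (fun p => ltY p.2 y) l ->
  exists x, P x /\ pairwise_on (same_order ltX ltY) ((x, y) :: l).
Proof.
move=> oX oY rP gl yl hl; pose sw (p : X * Y) := (p.2, p.1).
have [|||x [Px gx]] := @insert_rich _ _ ltY ltX oY oX P (map sw l) y rP.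
- exact: pairwise_on_swap.
- by rewrite -map_comp.
- by rewrite has_map.
exists x; split=> //; have /= := pairwise_on_swap gx; rewrite -map_comp.
by rewrite (_ : map _ l = l)// -[RHS]map_id; apply: eq_map => -[].
Qed.

Lemma has_belowl (Y : eqType) (z : Y) (l : seq (rat * Y)) (x : rat) :
  (0, z) \in l -> x \notin map fst l -> has (fun p => ltc p.1 x) l.
Proof.
move=> zl xl; apply/hasP; exists (0, z) => //=; rewrite ltc0.
by apply: contraNneq xl => ->; apply/mapP; exists (0, z).
Qed.

Lemma has_belowr (X : eqType) (z : X) (l : seq (X * rat)) (x : rat) :
  (z, 0) \in l -> x \notin map snd l -> has (fun p => ltc p.2 x) l.
Proof.
move=> zl xl; apply/hasP; exists (z, 0) => //=; rewrite ltc0.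
by apply: contraNneq xl => ->; apply/mapP; exists (z, 0).
Qed.

Lemma pairwise_on_graph (m : rat -> rat) (E : seq rat) :
  mono0 m -> pairwise_on (same_order ltc ltc) [seq (x, m x) | x <- E].
Proof.
by move=> mm _ _ /mapP[x _ ->] /mapP[y _ ->]; rewrite /same_order mono0_lt.
Qed.

(** The restriction of [m] to a finite set is a finite partial isomorphism, and back-and-forth
    extends it. The pair (0, 0) is included so that every new point, on either side, has an old one
    below it. *)
Lemma automorphism_extension (m : rat -> rat) (E : seq rat) :
  mono0 m -> m 0 = 0 ->
  exists g g', automorphism g g' /\ {in E, g =1 m}.
Proof.
move=> mm m0; pose l0 := [seq (x, m x) | x <- 0 :: E].
have l00 (l : seq (rat * rat)) : {subset l0 <= l} -> (0, 0) \in l.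
  by apply; rewrite /l0 /= m0 mem_head.
have rT := color_rich true.
have [//|x l l0l gl xl|y l l0l gl yl|g [g' [gK g'K mg _ gm]]] :=
    @isomorphism_extension _ _ ltc ltc (fun _ _ => True) l0 ltc_strict_total
      ltc_strict_total (pairwise_on_graph mm).
- have [|y [_ gy]] := insert_rich ltc_strict_total ltc_strict_total rT gl xl.
    exact: (has_belowl (l00 l l0l) xl).
  by exists y.
- have [|x [_ gx]] :=
    insert_rich_back ltc_strict_total ltc_strict_total rT gl yl.
    exact: (has_belowr (l00 l l0l) yl).
  by exists x.
exists g, g'; split; first by split=> // x y; rewrite mg.
by move=> x xE; apply: (gm (x, m x)); rewrite /l0 map_f// inE xE orbT.
Qed.

(** Back-and-forth starting from the identity on [F] and matching each new point with one of the
    other colour; it never gets stuck, as both colours are dense and cofinal. *)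
Lemma automorphism_color_swap (F : seq rat) : 0 \in F ->
  exists g g', [/\ automorphism g g', {in F, forall x, g x = x} &
    forall x, x \notin F ->
      g x \notin F /\ odd_fraction (g x) = ~~ odd_fraction x].
Proof.
move=> F0; pose l0 := [seq (x, id x) | x <- F].
pose C x y := if x \in F then y = x
  else y \notin F /\ odd_fraction y = ~~ odd_fraction x.
have [irr tr tot] := ltc_strict_total.
have diag (l : seq (rat * rat)) x : {subset l0 <= l} -> x \in F -> (x, x) \in l.
  by move=> l0l xF; apply: l0l; apply: map_f.
(* A point of [F] is already paired with itself, so order preservation lets no other point be paired
   with it. *)
have eqxy (l : seq (rat * rat)) x y : {subset l0 <= l} ->
    pairwise_on (same_order ltc ltc) ((x, y) :: l) ->
    (x \in F) || (y \in F) -> x = y.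
  move=> l0l gl xy; apply/eqP; apply: contraT => /tot.
  have h z : z \in F ->
      (ltc x z = ltc y z) * (ltc z x = ltc z y).
    move=> zF; have zl : (z, z) \in (x, y) :: l.
      by rewrite inE diag ?orbT.
    by have := gl _ _ (mem_head _ _) zl; have := gl _ _ zl (mem_head _ _).
  case/orP: xy => zF; have [e1 e2] := h _ zF; move: e1 e2; rewrite irr.
    by move=> <- <-.
  by move=> -> ->.
have [|x l l0l gl xl|y l l0l gl yl|g [g' [gK g'K mg Cg gm]]] :=
    @isomorphism_extension _ _ ltc ltc C l0 ltc_strict_total
      ltc_strict_total (@pairwise_on_graph id F (fun _ _ => id)).
- by move=> _ /mapP[x xF ->]; rewrite /C xF.
- have xF : x \notin F.
    apply: contra xl => xF.
    by apply/mapP; exists (x, x) => //; apply: diag.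
  have [|y [cy gy]] := insert_rich ltc_strict_total ltc_strict_total
    (color_rich (~~ odd_fraction x)) gl xl.
    exact: (has_belowl (diag l _ l0l F0) xl).
  exists y; split=> //; rewrite /C (negPf xF); split=> //.
  by apply: contra xF => yF; rewrite (eqxy _ _ _ l0l gy)// yF orbT.
- have yF : y \notin F.
    apply: contra yl => yF.
    by apply/mapP; exists (y, y) => //; apply: diag.
  have [|x [cx gx]] := insert_rich_back ltc_strict_total ltc_strict_total
    (color_rich (~~ odd_fraction y)) gl yl.
    exact: (has_belowr (diag l _ l0l F0) yl).
  exists x; split=> //; rewrite /C; case: ifPn => xF; last by rewrite cx negbK.
  by rewrite (eqxy _ _ _ l0l gx)// xF.
exists g, g'; split.
- by split=> // x y; rewrite mg.
- by move=> x xF; have := Cg x; rewrite /C xF.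
- by move=> x xF; have := Cg x; rewrite /C (negPf xF).
Qed.

(* [option rat] is the range of lifts: the cut order with a copy [None] of its
   least point [0] added on top, so that it covers the circle once. *)
Definition ltK (k k' : option rat) : bool :=
  match k, k' with
  | Some a, Some b => ltc a b
  | Some _, None => true
  | None, _ => false
  end.

Definition leK (k k' : option rat) : bool := (k == k') || ltK k k'.

Definition fold (k : option rat) : rat := odflt 0 k.

Lemma ltK_strict_total : strict_total ltK.
Proof.
have [irr tr tot] := ltc_strict_total.
split=> [[x|]|[x|] [y|] [z|]|[x|] [y|]] //=; first exact: tr.
by move=> xy; apply: tot; apply: contraNneq xy => ->.
Qed.

Lemma leK_Some a b : leK (Some a) (Some b) = lec a b.
Proof. by []. Qed.

(** A monotone lift goes around the circle at most once, so folding it respects the circular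
    order. *)
Lemma fold_circ (phi : rat -> option rat) :
  (forall x y, ltc x y -> leK (phi x) (phi y)) ->
  forall x y z, circ x y z -> circ (fold (phi x)) (fold (phi y)) (fold (phi z)).
Proof.
move=> mphi.
have mono x y : lec x y -> leK (phi x) (phi y).
  by move=> /orP[/eqP->|/mphi//]; rewrite /leK eqxx.
suff H x y z : lec x y -> lec y z ->
    circ (fold (phi x)) (fold (phi y)) (fold (phi z)).
  move=> x y z /circP[] /andP[h1 h2]; first exact: H.
  - by do 2 apply: circ_rot; apply: H.
  - by apply: circ_rot; apply: H.
move=> /mono + /mono.
case: (phi x) (phi y) (phi z) => [a|] [b|] [c|] //=.
- exact: circ_lec.
- move=> ab _; apply: circ_rot; apply: circ_lec ab; exact: lec0.
- by move=> _ _; do 2 apply: circ_rot; apply: circ_xx.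
- by move=> _ _; apply: circ_xx.
Qed.

(** Every possible value of a lift is blown up to a copy of the rationals, ordered
    lexicographically, and a least point [None] is added. This is a countable dense order with a
    least and no greatest point, hence a copy of the cut order. *)
Definition ltD (d d' : option (option rat * rat)) : bool :=
  match d, d' with
  | Some p, Some q => ltK p.1 q.1 || (p.1 == q.1) && (p.2 < q.2)
  | None, Some _ => true
  | _, None => false
  end.

Definition keyD (d : option (option rat * rat)) : option rat :=
  if d is Some p then p.1 else Some 0.

Lemma ltD_strict_total : strict_total ltD.
Proof.
have [irr tr tot] := ltK_strict_total.
split=> [[[k r]|]|[[k r]|] [[k' r']|] [[k'' r'']|]|[[k r]|] [[k' r']|]] //=.
- by rewrite irr eqxx ltxx.
- move=> /orP[h1|/andP[/eqP-> h1]] /orP[h2|/andP[/eqP<- h2]].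
  + by rewrite (tr _ _ _ h1 h2).
  + by rewrite h1.
  + by rewrite h2.
  + by rewrite eqxx (lt_trans h1 h2) orbT.
- have [->|/tot/orP[->|->]] := eqVneq k k'; rewrite ?orbT//.
  rewrite irr /= => ne; apply: lt_total.
  by apply: contraNneq ne => ->.
Qed.

Lemma lec0K k : leK (Some 0) k.
Proof. by case: k => // a; rewrite leK_Some lec0. Qed.

Lemma keyD_mono d d' : ltD d d' -> leK (keyD d) (keyD d').
Proof.
case: d d' => [[k r]|] [[k' r']|] //=; last by move=> _; apply: lec0K.
by move=> /orP[|/andP[/eqP-> _]]; rewrite /leK ?eqxx// => ->; rewrite orbT.
Qed.

(** The blown-up fibres have no endpoints, so there is room in any fibre between the two keys: at
    the midpoint if both ends lie in it, and next to one end, at distance 1, otherwise. *)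
Lemma keyD_between d d' k : ltD d d' -> leK (keyD d) k -> leK k (keyD d') ->
  exists e, [/\ ltD d e, ltD e d' & keyD e = k].
Proof.
have [irr tr tot] := ltK_strict_total.
have low r : r - 1 < r :> rat by lra.
have upp r : r < r + 1 :> rat by lra.
case: d d' => [[k1 r1]|] [[k2 r2]|] //=; last first.
  move=> _ _ kk2; exists (Some (k, r2 - 1)); split=> //=; rewrite low andbT.
  by rewrite orbC.
move=> h /orP[/eqP e1|k1k] /orP[/eqP e2|kk2].
- move: h; rewrite e1 e2 irr eqxx /= => h.
  by exists (Some (k2, (r1 + r2) / 2)); rewrite /= irr eqxx; split=> //=; lra.
- by exists (Some (k, r1 + 1)); rewrite /= kk2 e1 eqxx upp orbT.
- by exists (Some (k, r2 - 1)); rewrite /= k1k e2 eqxx low orbT.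
- by exists (Some (k, r2 - 1)); rewrite /= k1k kk2.
Qed.

Lemma keyD_above d k : leK (keyD d) k -> exists e, ltD d e /\ keyD e = k.
Proof.
case: d => [[k1 r1]|] /= h; last by exists (Some (k, 0)).
exists (Some (k, r1 + 1)); split=> //=.
have -> : r1 < r1 + 1 by lra.
by rewrite andbT orbC.
Qed.

Lemma ltD_rich : rich ltD (fun=> True).
Proof.
split=> [d d' h|d].
  have [|e [? ? _]] := keyD_between h (keyD_mono h); last by exists e.
  by rewrite /leK eqxx.
have [|e [? _]] := @keyD_above d (keyD d); last by exists e.
by rewrite /leK eqxx.
Qed.

(** The two existence clauses provide, between two points or above one, a point with any value that
    monotonicity allows. This is what the forth construction needs to factor an arbitrary lift
    through [tau]. *)
Definition universal_lift (tau : rat -> option rat) :=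
  [/\ tau 0 = Some 0, forall x y, ltc x y -> leK (tau x) (tau y),
    forall a b k, ltc a b -> leK (tau a) k -> leK k (tau b) ->
      exists y, [/\ ltc a y, ltc y b & tau y = k]
  & forall a k, leK (tau a) k -> exists y, ltc a y /\ tau y = k].

(** An isomorphism of the cut order with its blow-up, followed by the projection to keys. *)
Lemma universal_lift_exists : exists tau, universal_lift tau.
Proof.
pose l0 : seq (rat * option (option rat * rat)) := [:: (0, None)].
have [||x l l0l gl xl|y l l0l gl yl|f [f' [fK f'K mf _ f0]]] :=
    @isomorphism_extension _ _ ltc ltD (fun _ _ => True) l0 ltc_strict_total
      ltD_strict_total.
- by move=> p q; rewrite !inE => /eqP-> /eqP->.
- by [].
- have [|y [_ gy]] := insert_rich ltc_strict_total ltD_strict_total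
    ltD_rich gl xl; last by exists y.
  by apply: has_belowl xl; apply: l0l; apply: mem_head.
- have [|x [_ gx]] := insert_rich_back ltc_strict_total ltD_strict_total
    (color_rich true) gl yl; last by exists x.
  have zl : (0, None) \in l by apply: l0l; apply: mem_head.
  apply/hasP; exists (0, None) => //=; case: y yl => //.
  by case/negP; apply/mapP; exists (0, None).
have f00 : f 0 = None by apply: (f0 (0, None)); apply: mem_head.
have mf' x d : ltc x (f' d) = ltD (f x) d by rewrite mf f'K.
have mf'' x d : ltc (f' d) x = ltD d (f x) by rewrite mf f'K.
exists (keyD \o f); split=> /=.
- by rewrite f00.
- by move=> x y; rewrite mf; apply: keyD_mono.
- move=> a b k; rewrite mf => ab ak kb.
  have [e [ae eb ek]] := keyD_between ab ak kb.
  by exists (f' e); rewrite mf' mf'' f'K.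
- move=> a k /keyD_above[e [ae ek]].
  by exists (f' e); rewrite mf' f'K.
Qed.

(** The forth construction with the side condition [tau y = phi x], started from [m] on [F], where
    that condition already holds. *)
Lemma lift_through (tau phi : rat -> option rat) (m : rat -> rat)
    (F : seq rat) :
  universal_lift tau -> phi 0 = Some 0 ->
  (forall x y, ltc x y -> leK (phi x) (phi y)) ->
  mono0 m -> m 0 = 0 -> {in F, forall x, tau (m x) = phi x} ->
  exists m', [/\ mono0 m', m' 0 = 0, forall x, tau (m' x) = phi x
    & {in F, m' =1 m}].
Proof.
move=> [tau0 mtau between above] phi0 mphi mm m0 mF.
pose l0 := [seq (x, m x) | x <- 0 :: F].
have l00 (l : seq (rat * rat)) : {subset l0 <= l} -> (0, 0) \in l.
  by apply; rewrite /l0 /= m0 mem_head.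
have [|x l l0l gl Cl xl|m' [mm' Cm' m'F]] :=
    @embedding_extension _ _ ltc ltc (fun x y => tau y = phi x) l0
      ltc_strict_total ltc_strict_total (pairwise_on_graph mm).
- move=> _ /mapP[x + ->] /=; rewrite inE => /orP[/eqP->|/mF//].
  by rewrite m0 tau0 phi0.
- have [p1 /andP[p1l p1x]] := insert_pair ltc_strict_total ltc_strict_total
    gl xl (has_belowl (l00 l l0l) xl).
  have l1 : leK (tau p1.2) (phi x) by rewrite (Cl _ p1l); apply: mphi.
  move=> [[p2 /andP[p2l xp2] ins]|ins].
    have l2 : leK (phi x) (tau p2.2) by rewrite (Cl _ p2l); apply: mphi.
    have [|y [h1 h2 ty]] := between p1.2 p2.2 (phi x) _ l1 l2.
      by rewrite -(gl _ _ p1l p2l); apply: ltc_trans xp2.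
    by exists y; split=> //; apply: ins.
  have [y [h1 ty]] := above p1.2 (phi x) l1.
  by exists y; split=> //; apply: ins.
exists m'; split=> //.
- by move=> x y; rewrite mm'.
- by apply: (m'F (0, 0)); apply: l00.
- by move=> x xF; apply: (m'F (x, m x)); rewrite /l0 map_f// inE xF orbT.
Qed.

(** * Classification of the polymorphisms *)

Definition coincide (T : Type) (a b c : T) : Prop := [\/ a = b, b = c | a = c].

Definition two_valued (T : Type) (f : T -> rat) : Prop :=
  forall x y z, coincide (f x) (f y) (f z).

Lemma circ_coincide a b c : coincide a b c -> circ a b c.
Proof.
move=> [->|->|->]; first exact: circ_xx.
- by do 2 apply: circ_rot; apply: circ_xx.
- by apply: circ_rot; apply: circ_xx.
Qed.

Lemma Ncoincide (T : Type) (a b c : T) :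
  ~ coincide a b c -> [/\ a <> b, b <> c & a <> c].
Proof.
by move=> h; split=> e; apply: h;
  solve [constructor 1; exact: e|constructor 2; exact: e
    |constructor 3; exact: e].
Qed.

Section Unary.
Variables (n : nat) (f : ('I_n -> rat) -> rat).
Hypothesis fE : forall a b c : 'I_n -> rat,
  (forall i, coincide (a i) (b i) (c i)) -> coincide (f a) (f b) (f c).

Definition upd (x : 'I_n -> rat) (i : 'I_n) (a : rat) : 'I_n -> rat :=
  fun j => if j == i then a else x j.

(** Off [i] the points [x] and [x'] agree, and at [i] the point [w] agrees with one of them, so the
    coincidence hypothesis applies to the three. *)
Lemma slice_values i x x' w : (forall j, j != i -> x j = x' j) -> f x <> f x' ->
  w i = x i \/ w i = x' i -> f w = f x \/ f w = f x'.
Proof.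
move=> xx' ne wi; have [//|e|e|e] := @fE x x' w; last 3 first.
- by case: ne.
- by right.
- by left.
move=> j; have [->|/xx' ->] := eqVneq j i; last by constructor 1.
by case: wi => ->; [constructor 3|constructor 2].
Qed.

Lemma upd_same x i a : upd x i a i = a.
Proof. by rewrite /upd eqxx. Qed.

Lemma upd_other x i a j : j != i -> upd x i a j = x j.
Proof. by rewrite /upd => /negPf->. Qed.

(** Let [s] be the value on the line at the coordinate [u i]. Comparing with a line point of another
    value leaves for [f u] only [s] or that value; of three distinct line values at least two differ
    from [s], which leaves [s]. *)
Lemma unary_of_line x i a b c :
  ~ coincide (f (upd x i a)) (f (upd x i b)) (f (upd x i c)) ->
  forall u v, u i = v i -> f u = f v.
Proof.
move=> /(@Ncoincide rat)[ab bc ac].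
suff H u : f u = f (upd x i (u i)).
  by move=> u v uv; rewrite (H u) (H v) uv.
have alt t : f (upd x i (u i)) <> f (upd x i t) ->
    f u = f (upd x i (u i)) \/ f u = f (upd x i t).
  move=> ne; apply: (slice_values (i := i) _ ne) => [j ji|].
    by rewrite !upd_other.
  by left; rewrite upd_same.
have ha := alt a; have hb := alt b; have hc := alt c.
set s := f (upd x i (u i)) in ha hb hc *.
have [ea|/ha[//|ea]] := pselect (s = f (upd x i a)).
  have [eb|/hb[//|eb]] := pselect (s = f (upd x i b)); first congruence.
  have [ec|/hc[//|ec]] := pselect (s = f (upd x i c)); congruence.
have [eb|/hb[//|eb]] := pselect (s = f (upd x i b)); last congruence.
have [ec|/hc[//|ec]] := pselect (s = f (upd x i c)); congruence.
Qed.

(** The coordinates of [x] are replaced by those of [y] one at a time, and some single replacement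
    changes the value. *)
Lemma single_step x y : f x <> f y -> exists i v v',
  [/\ forall j, j != i -> v j = v' j, forall j, v j = x j \/ v j = y j,
      forall j, v' j = x j \/ v' j = y j, x i <> y i & f v <> f v'].
Proof.
move=> ne; pose h (s : seq 'I_n) j := if j \in s then y j else x j.
have hxy s j : h s j = x j \/ h s j = y j.
  by rewrite /h; case: ifP; [right|left].
have : f (h (enum 'I_n)) <> f x.
  rewrite (_ : h _ = y); first by move=> e; apply: ne.
  by apply/funext => j; rewrite /h mem_enum.
elim: (enum 'I_n) => [|i s IH].
  by rewrite (_ : h [::] = x).
have [<-|ns _] := pselect (f (h s) = f x); last exact: IH.
move=> d; exists i, (h (i :: s)), (h s); split=> //.
  by move=> j ji; rewrite /h inE (negPf ji).
move=> e; apply: d; congr f; apply/funext => j; rewrite /h inE.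
by have [->|] //= := eqVneq j i; case: ifP.
Qed.

Lemma two_valued_or_unary :
  two_valued f \/ exists i, forall u v, u i = v i -> f u = f v.
Proof.
have [un|nun] := pselect (exists i, forall u v, u i = v i -> f u = f v).
  by right.
left=> x0 y0 z0; apply: contrapT => /(@Ncoincide rat)[nxy nyz nxz].
have line x i a b c :
    coincide (f (upd x i a)) (f (upd x i b)) (f (upd x i c)).
  apply: contrapT => h; apply: nun; exists i; exact: unary_of_line h.
have [i [x [x' [xx' _ _ _ pq]]]] := single_step nxy.
(* [x] and [x'] lie on one line, which carries only two values; [w] has a third one. *)
have [w wp wq] : exists2 w, f w <> f x & f w <> f x'.
  have [ex|] := pselect (f x0 = f x \/ f x0 = f x'); last first.
    by move=> /not_orP[? ?]; exists x0.
  have [ey|] := pselect (f y0 = f x \/ f y0 = f x'); last first.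
    by move=> /not_orP[? ?]; exists y0.
  by exists z0 => e; case: ex; case: ey; congruence.
(* The line point at coordinate [w i] has the value of [x] or of [x']; [key], applied with either in
   the role of [a], excludes both. *)
suff key a a' : (forall j, j != i -> a j = a' j) -> f a <> f a' ->
    f w <> f a -> f w <> f a' -> f (upd a i (w i)) <> f a.
  have updK z : z = upd z i (z i).
    by apply/funext => j; rewrite /upd; case: eqP => // ->.
  have ex' : x' = upd x i (x' i).
    by apply/funext => j; rewrite /upd; case: eqP => [->//|/eqP/xx' ->].
  have := line x i (x i) (x' i) (w i).
  rewrite -updK -ex' => -[e|e|e]; first by case: pq.
    apply: (key x' x) => //; first by move=> j /xx'.
      by move=> /esym.
    rewrite e; congr f; apply/funext => j; rewrite /upd.
    by case: eqP => // /eqP/xx' ->.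
  by apply: (key x x') => //; rewrite -e.
move=> {x x' xx' pq wp wq} xx' pq wp wq vp.
rename a into x; rename a' into x'.
pose v := upd x i (w i); pose w1 := upd w i (x i); pose w2 := upd w i (x' i).
rewrite -/v in vp.
have updK z : z = upd z i (z i).
  by apply/funext => j; rewrite /upd; case: eqP => // ->.
have w1v : f w1 = f x \/ f w1 = f x'.
  by apply: slice_values xx' pq _; left; rewrite /w1 upd_same.
have w2v : f w2 = f x \/ f w2 = f x'.
  by apply: slice_values xx' pq _; right; rewrite /w2 upd_same.
have ww : f w1 = f w2.
  have := line w i (w i) (x i) (x' i); rewrite -updK -/w1 -/w2.
  by case=> // e; case: w1v; case: w2v; congruence.
have ww1 : f w <> f w1 by case: w1v; congruence.
have w_w1 j : j != i -> w j = w1 j by move=> ?; rewrite /w1 upd_other.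
have vw1 : f v = f w1.
  have [|e|//] := @slice_values i w w1 v w_w1 ww1; last by congruence.
  by left; rewrite /v upd_same.
have vw : f v <> f w by congruence.
(* Between [v] and [w], which agree at [i], the value changes along another direction [j]; it is
   shown that both ends of this change have the value [f x]. *)
have [j [y [y' [yy' yv y'v ji nyy']]]] := single_step vw.
have yi : y i = w i by case: (yv i) => ->//; rewrite /v upd_same.
have y'i : y' i = w i by case: (y'v i) => ->//; rewrite /v upd_same.
have {}ji : i != j.
  by apply/eqP => e; apply: ji; rewrite -e /v upd_same.
have inj_ t : t = y \/ t = y' -> f t = f x.
  move=> ty.
  have t_wp : f t = f w \/ f t = f x.
    rewrite -vp vw1; apply: slice_values w_w1 ww1 _.
    by left; case: ty => ->.
  pose x'' := upd x' j (t j).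
  have x''i : x'' i = x' i by rewrite /x'' upd_other.
  have h1 : f x'' = f x \/ f x'' = f x'.
    by apply: slice_values xx' pq _; right.
  (* The value of [x''] is one of two in direction [i] and one of two in direction [j]; only [f x]
     is common to both pairs. *)
  have h2 : f x'' = f y \/ f x'' = f y'.
    apply: slice_values yy' nyy' _; rewrite /x'' upd_same.
    by case: ty => ->; [left|right].
  have ywp s : s = y \/ s = y' -> f s = f w \/ f s = f x.
    move=> sy; rewrite -vp vw1; apply: slice_values w_w1 ww1 _.
    by left; case: sy => ->.
  have h3 : f x'' = f w \/ f x'' = f x.
    by case: h2 => ->; apply: ywp; [left|right].
  have x''p : f x'' = f x by case: h1; case: h3; congruence.
  have nx : f x' <> f x'' by congruence.
  have xj k : k != j -> x' k = x'' k by move=> ?; rewrite /x'' upd_other.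
  have [] := slice_values xj nx (w := t); first by right; rewrite /x'' upd_same.
    by case: t_wp; congruence.
  by case: t_wp; congruence.
by apply: nyy'; rewrite (inj_ y) ?(inj_ y'); [|right|left].
Qed.

End Unary.

(** * Unary maps preserving the circular order *)

Definition circ_preserving (g : rat -> rat) : Prop :=
  forall x y z, circ x y z -> circ (g x) (g y) (g z).

Lemma circ_coincideP a b c : coincide a b c <-> circ a b c /\ circ b a c.
Proof.
split=> [h|[h1 h2]].
  split; apply: circ_coincide => //.
  by case: h => ->; [constructor 1|constructor 3|constructor 2].
have := circ_anti h1 (circ_rot h2); exact.
Qed.

(** Going up from 0 the values increase in the cut order, except that they may at last return to 0,
    where they then remain. *)
Definition arc_map (g : rat -> rat) : Prop :=
  (forall x y, ltc x y -> g y <> 0 -> lec (g x) (g y)) /\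
  (forall w x y, ltc w x -> ltc x y -> g w <> 0 -> g x = 0 -> g y = 0).

Lemma circ_preserving_arc (g : rat -> rat) : circ_preserving g -> g 0 = 0 ->
  ~ two_valued g -> arc_map g.
Proof.
move=> gc g0 ntv.
have mono x y : ltc x y -> g y <> 0 -> lec (g x) (g y).
  move=> xy /eqP gy; apply: circ0 gy; rewrite -g0; apply: gc.
  by apply: circ_lec (ltcW xy); exact: lec0.
split=> // w x y wx xy gw gx; apply: contrapT => gy.
(* A map that leaves 0 again after returning to it must come back to the same value. *)
have gwy : g w = g y.
  apply: lec_anti; first by apply: mono gy; apply: ltc_trans xy.
  have : circ (g w) (g x) (g y) by apply: gc; apply: circ_lec; exact: ltcW.
  rewrite gx => /circ_rot /circ_rot /circ_rot /circ_rot /circ0; apply.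
  exact/eqP.
(* A third value is taken at some [t]. Wherever [t] lies relative to [w], [x] and [y], both
   orientations of the three distinct values are forced. *)
have [t t0 ta] : exists2 t, g t <> 0 & g t <> g y.
  apply: contrapT => h; apply: ntv.
  have val t : g t = 0 \/ g t = g y.
    by apply: contrapT => /not_orP[? ?]; apply: h; exists t.
  move=> a b c; case: (val a) (val b) (val c) => -> [] -> [] ->;
    solve [constructor 1; done|constructor 2; done|constructor 3; done].
have no : circ (g t) (g y) 0 -> circ (g t) 0 (g y) -> False.
  by move=> h1 h2; have [] := circ_anti h1 h2.
have zero_least u : lec 0 u by exact: lec0.
have [wt|tw] := boolP (lec w t); last first.
  have {tw} tw : lec t w by have := lec_total t w; rewrite (negPf tw) orbF.
  apply: no.
    by rewrite -gwy -gx; apply/gc/circ_lec => //; exact: ltcW.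
  rewrite -gx; apply/gc/circ_lec; last exact: ltcW.
  exact: lec_trans (ltcW wx).
have tw_ : circ (g t) 0 (g y).
  by rewrite -gwy -g0; apply/gc/circ_rot/circ_rot/circ_lec.
have [xt|tx] := boolP (lec x t); last first.
  have {tx} tx : lec t x by have := lec_total t x; rewrite (negPf tx) orbF.
  apply: no; last by rewrite -gx; apply/gc/circ_lec => //; exact: ltcW.
  rewrite -g0; apply/gc/circ_rot/circ_lec => //.
  exact: lec_trans (ltcW xy).
have [yt|ty] := boolP (lec y t); last first.
  have {ty} ty : lec t y by have := lec_total t y; rewrite (negPf ty) orbF.
  by apply: no => //; rewrite -g0; apply/gc/circ_rot/circ_lec.
apply: no => //.
by rewrite -gwy -gx; apply/gc/circ_rot/circ_rot/circ_lec => //; exact: ltcW.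
Qed.

Lemma circ_trans a x y z : x <> y -> y <> z -> x <> z -> y <> a ->
  x <> a -> z <> a ->
  circ a x y -> circ a y z -> circ a x z.
Proof.
move=> xy yz xz ya xa za h1 h2; have [//|h3] := circ_total a x z.
exfalso; move: h1 h2 h3.
move=> [/andP[]|[/andP[]|/andP[]]] ? ? [/andP[]|[/andP[]|/andP[]]] ? ?
  [/andP[]|[/andP[]|/andP[]]] ? ?; lra.
Qed.

Definition circb x y z : bool := `[< circ x y z >].

Lemma circbP x y z : reflect (circ x y z) (circb x y z).
Proof. exact: asboolP. Qed.

Lemma circb_swap a b c : ~ coincide a b c -> circb a c b = ~~ circb a b c.
Proof.
move=> ne; apply/circbP/negP => [h /circbP h'|].
  by apply: ne; apply: circ_anti h' h.
by have [/circbP|//] := circ_total a b c.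
Qed.

Lemma circb_rot a b c : circb a b c = circb b c a.
Proof.
apply/circbP/circbP; first exact: circ_rot.
by move=> h; do 2 apply: circ_rot.
Qed.

(** * Unary maps preserving separation *)

Definition sep_preserving (g : rat -> rat) : Prop :=
  forall x y z t, sep x y z t -> sep (g x) (g y) (g z) (g t).

Lemma sepb x y z t : sep x y z t <->
  circb x y z && circb x t y || circb x z y && circb x y t.
Proof.
rewrite /sep; split=> [[[/circbP-> /circbP->]//|[/circbP-> /circbP->]]|].
  by rewrite orbT.
by case/orP => /andP[/circbP ? /circbP ?]; [left|right].
Qed.

Section SepExchange.
Variable g : rat -> rat.
Hypothesis gs : sep_preserving g.

Definition same_orientation x y z := circb x y z = circb (g x) (g y) (g z).
Definition distinct_values x y z := ~ coincide (g x) (g y) (g z).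

Lemma distinct_values_points x y z : distinct_values x y z ->
  ~ coincide x y z.
Proof.
by move=> h e; apply: h; case: e => ->;
  [constructor 1|constructor 2|constructor 3].
Qed.

(* Of four points with distinct images exactly one of the three pairings is
   separated, both for the points and for their images. *)
Lemma orientation_exchange a b c d : distinct_values a b c ->
  distinct_values a b d -> same_orientation a b c -> same_orientation a b d.
Proof.
move=> vc vd; rewrite /same_orientation.
have sc := circb_swap (distinct_values_points vc).
have sd := circb_swap (distinct_values_points vd).
have sc' := circb_swap vc; have sd' := circb_swap vd.
have := gs (x := a) (y := b) (z := c) (t := d).
rewrite !sepb sc sd sc' sd'.
have [e|ncd] := eqVneq (g c) (g d).
  rewrite e; case: (circb a b c); case: (circb a b d);
    case: (circb (g a) (g b) (g d)) => //= h; by have := h isT.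
have [nab nbc nac] := Ncoincide vc; have [_ nbd nad] := Ncoincide vd.
have vcd : distinct_values a c d by case=> // e; move/eqP: ncd; congruence.
have scd := circb_swap (distinct_values_points vcd).
have scd' := circb_swap vcd.
have := gs (x := a) (y := c) (z := b) (t := d).
have := gs (x := a) (y := d) (z := b) (t := c).
rewrite !sepb sc sd sc' sd' scd scd'.
(* Transitivity of the order cut at [a], applied to the images with [h := g] and to the points with
   [h := id], leaves sign patterns that the separation hypotheses settle. *)
have tr (h : rat -> rat) : h a <> h b -> h b <> h c -> h a <> h c ->
    h b <> h d -> h a <> h d -> h c <> h d ->
    circb (h a) (h b) (h c) -> circb (h a) (h c) (h d) ->
    circb (h a) (h b) (h d).
  move=> *; apply/circbP; apply: (@circ_trans _ _ (h c)); try congruence;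
    exact/circbP.
have tr' (h : rat -> rat) : h a <> h b -> h b <> h c -> h a <> h c ->
    h b <> h d -> h a <> h d -> h c <> h d ->
    circb (h a) (h d) (h c) -> circb (h a) (h c) (h b) ->
    circb (h a) (h d) (h b).
  move=> *; apply/circbP; apply: (@circ_trans _ _ (h c)); try congruence;
    exact/circbP.
have inj x y : g x <> g y -> x <> y by move=> h e; apply: h; rewrite e.
have ncd' : g c <> g d by apply/eqP.
have := tr g nab nbc nac nbd nad ncd'.
have := tr' g nab nbc nac nbd nad ncd'.
have := tr id (inj _ _ nab) (inj _ _ nbc) (inj _ _ nac) (inj _ _ nbd)
  (inj _ _ nad) (inj _ _ ncd').
have := tr' id (inj _ _ nab) (inj _ _ nbc) (inj _ _ nac) (inj _ _ nbd)
  (inj _ _ nad) (inj _ _ ncd').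
rewrite /= sc sd sc' sd' scd scd'.
case: (circb a b c); case: (circb a b d); case: (circb a c d);
case: (circb (g a) (g b) (g c)); case: (circb (g a) (g b) (g d));
case: (circb (g a) (g c) (g d)) => //= h1 h2 h3 h4 h5 h6 h7;
  solve [by have := h1 isT isT|by have := h2 isT isT|by have := h3 isT isT
  |by have := h4 isT isT|by have := h5 isT|by have := h6 isT
  |by have := h7 isT].
Qed.

Lemma same_orientation_rot a b c :
  same_orientation a b c -> same_orientation b c a.
Proof. by rewrite /same_orientation (circb_rot a b c) (circb_rot (g a)). Qed.

Lemma same_orientation_swap a b c : distinct_values a b c ->
  same_orientation a b c -> same_orientation a c b.
Proof.
move=> v; rewrite /same_orientation (circb_swap v) => <-.
by rewrite (circb_swap (distinct_values_points v)).
Qed.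

Lemma distinct_values_rot a b c : distinct_values a b c ->
  distinct_values b c a.
Proof.
by move=> v e; apply: v; case: e => ->;
  [constructor 2|constructor 3|constructor 1].
Qed.

Lemma distinct_values_swap a b c : distinct_values a b c ->
  distinct_values a c b.
Proof.
by move=> v e; apply: v; case: e => ->;
  [constructor 3|constructor 2|constructor 1].
Qed.

(** One triple is turned into the other by exchanging one point at a time, in an order that keeps
    the three images distinct. *)
Lemma same_orientation_all u v w x y z : distinct_values u v w ->
  distinct_values x y z -> same_orientation u v w -> same_orientation x y z.
Proof.
have step a b c d : distinct_values a b c -> distinct_values d b c ->
    same_orientation a b c -> same_orientation d b c.
  move=> v1 v2 /same_orientation_rot s; do 2 apply: same_orientation_rot.
  apply: (orientation_exchange _ _ s); exact: distinct_values_rot.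
have mk a b c : g a <> g b -> g b <> g c -> g a <> g c -> distinct_values a b c.
  by move=> ? ? ? [].
move=> vu vx su; have [uv vw uw] := Ncoincide vu.
(* At most two of the three images can be [g v] or [g w]; a rotation puts a point with another image
   first. *)
suff H x' y' z' : distinct_values x' y' z' -> g x' <> g v -> g x' <> g w ->
    same_orientation x' y' z'.
  have [xy yz xz] := Ncoincide vx.
  have [ex|] := pselect (g x = g v \/ g x = g w); last first.
    by move=> /not_orP[? ?]; apply: H.
  have [ey|] := pselect (g y = g v \/ g y = g w); last first.
    move=> /not_orP[? ?]; do 2 apply: same_orientation_rot; apply: H => //.
    exact: distinct_values_rot.
  apply: same_orientation_rot; apply: H => [| |]; last 2 first.
  - by case: ex; case: ey; congruence.
  - by case: ex; case: ey; congruence.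
  - by do 2 apply: distinct_values_rot.
move=> vx' xv xw; have [xy yz xz] := Ncoincide vx'.
have s1 : same_orientation x' v w by apply: step vu _ su; apply: mk.
have v1 : distinct_values x' v w by apply: mk.
have [yw|yw] := pselect (g y' = g w).
  have v2 : distinct_values x' z' w by apply: mk; congruence.
  have s2 : same_orientation x' z' w.
    apply: same_orientation_swap; first exact: distinct_values_swap.
    apply: (orientation_exchange (distinct_values_swap v1)
      (distinct_values_swap v2)).
    exact: same_orientation_swap.
  apply: same_orientation_swap; first exact: distinct_values_swap.
  exact: (orientation_exchange v2 (distinct_values_swap vx') s2).
have v2 : distinct_values x' y' w by apply: mk; congruence.
apply: (orientation_exchange v2 vx').
apply: same_orientation_swap; first exact: distinct_values_swap.
apply: (orientation_exchange (distinct_values_swap v1)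
  (distinct_values_swap v2)).
exact: same_orientation_swap.
Qed.

End SepExchange.

Lemma circ_opp a b c : circ a c b -> circ (- a) (- b) (- c).
Proof.
rewrite /circ !lerN2 => -[/andP[h k]|[/andP[h k]|/andP[h k]]];
  rewrite h k /=; solve [by left|by right; left|by right; right].
Qed.

(** On triples with distinct images the orientation is either always kept or always reversed;
    negation reverses it back. *)
Lemma sep_preserving_circ (g : rat -> rat) : sep_preserving g ->
  circ_preserving g \/ circ_preserving (fun x => - g x).
Proof.
move=> gs; have [tv|ntv] := pselect (two_valued g).
  by left=> x y z _; apply: circ_coincide.
have [u [v [w vu]]] : exists u v w, distinct_values g u v w.
  apply: contrapT => h; apply: ntv => x y z; apply: contrapT => h'.
  by apply: h; exists x, y, z.
have [su|nsu] := pselect (same_orientation g u v w).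
  left=> x y z /circbP h.
  have [/circ_coincide//|vx] := pselect (coincide (g x) (g y) (g z)).
  by apply/circbP; rewrite -(same_orientation_all gs vu vx su).
right=> x y z /circbP h; apply: circ_opp; apply/circbP.
have [c|vx] := pselect (coincide (g x) (g y) (g z)).
  apply/circbP; apply: circ_coincide.
  by case: c => ->; [constructor 3|constructor 2|constructor 1].
rewrite (circb_swap vx); apply/negP => h'; apply: nsu.
by apply: (same_orientation_all gs vx vu); rewrite /same_orientation h h'.
Qed.

(** * Lifts and neighbourhoods *)

(** [U] marks the final segment on which the value 0 is read as the top copy of the cut point. *)
Definition lift_at (g : rat -> rat) (U : rat -> bool) (x : rat) : option rat :=
  if U x then None else Some (g x).

Lemma lift_at_mono (g : rat -> rat) (U : rat -> bool) :
  (forall x y, U x -> ltc x y -> U y) ->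
  (forall x y, ltc x y -> ~~ U y -> lec (g x) (g y)) ->
  forall x y, ltc x y -> leK (lift_at g U x) (lift_at g U y).
Proof.
move=> Uup Um x y xy; rewrite /lift_at; case: ifPn => Ux.
  by rewrite (Uup _ _ Ux xy) /leK eqxx.
by case: ifPn => // Uy; rewrite leK_Some; apply: Um.
Qed.

Definition top_zeros (g : rat -> rat) (x : rat) : bool :=
  `[< g x = 0 /\ exists w, ltc w x /\ g w <> 0 >].

Lemma top_zeros_up g : arc_map g ->
  forall x y, top_zeros g x -> ltc x y -> top_zeros g y.
Proof.
move=> [_ g2] x y /asboolP[gx [w [wx gw]]] xy; apply/asboolP; split.
  exact: g2 wx xy gw gx.
by exists w; split=> //; apply: ltc_trans xy.
Qed.

Lemma top_zeros_mono g : arc_map g ->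
  forall x y, ltc x y -> ~~ top_zeros g y -> lec (g x) (g y).
Proof.
move=> [g1 _] x y xy /asboolPn Uy.
have [gy|gy] := pselect (g y = 0); last exact: g1.
have [gx|gx] := pselect (g x = 0); first by rewrite gx gy lecxx.
by case: Uy; split=> //; exists x.
Qed.

(* A neighbour [g] of [g0] factors through [tau]; a lift of [g0] is chosen that
   agrees with the lift of [g] on the support [F0]. *)
Lemma common_lift (tau : rat -> option rat) (g0 : rat -> rat) (F0 : seq rat) :
  universal_lift tau -> arc_map g0 -> g0 0 = 0 ->
  exists F : seq rat, forall g, arc_map g -> g 0 = 0 -> {in F, g =1 g0} ->
  exists m m', [/\ mono0 m /\ m 0 = 0, mono0 m' /\ m' 0 = 0, {in F0, m =1 m'},
    forall x, g x = fold (tau (m x)) & forall x, g0 x = fold (tau (m' x))].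
Proof.
move=> tauU a0 g00; pose above x y := ltc x y /\ g0 y <> 0.
pose below x y := ltc y x /\ g0 y <> 0.
(* For each support point, witnesses of nonzero values of [g0] above and below it are added to [F],
   so that [g] is nonzero there as well. *)
have /choice[wa waP] x : exists y, (exists z, above x z) -> above x y.
  by have [[y]|n] := pselect (exists z, above x z); [exists y|exists 0].
have /choice[wb wbP] x : exists y, (exists z, below x z) -> below x y.
  by have [[y]|n] := pselect (exists z, below x z); [exists y|exists 0].
exists (F0 ++ map wa F0 ++ map wb F0) => g ag g_0 gF.
have gF0 x : x \in F0 -> g x = g0 x by move=> xF; apply: gF; rewrite mem_cat xF.
have gwa x : x \in F0 -> g (wa x) = g0 (wa x).
  by move=> xF; apply: gF; rewrite !mem_cat map_f ?orbT.
have gwb x : x \in F0 -> g (wb x) = g0 (wb x).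
  by move=> xF; apply: gF; rewrite !mem_cat (map_f wb) ?orbT.
pose U := top_zeros g.
(* The top segment for [g0] is enlarged by everything above a support point that [g] lifts to the
   top. The witnesses [wa] show that [g0] vanishes there, and [wb] that no support point is lifted
   to the top for [g0] alone. *)
pose U0 x :=
  `[< exists x', [/\ x' \in F0, U x' & lec x' x] >] || top_zeros g0 x.
have U0zero x : U0 x -> g0 x = 0.
  move=> /orP[/asboolP[x' [x'F Ux' x'x]]|/asboolP[]//].
  have gx' : g x' = 0 by case/asboolP: (Ux').
  move: x'x => /orP[/eqP<-|x'x]; first by rewrite -gF0.
  apply: contrapT => gx; have [] := waP x' _; first by exists x.
  rewrite -gwa// => x'w; apply.
  by have /asboolP[] := top_zeros_up ag Ux' x'w.
have U0up x y : U0 x -> ltc x y -> U0 y.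
  move=> /orP[/asboolP[x' [x'F Ux' x'x]]|Ux] xy; apply/orP.
    left; apply/asboolP; exists x'; split=> //.
    by apply: lec_trans x'x _; apply: ltcW.
  by right; apply: top_zeros_up xy.
have U0U x : x \in F0 -> U0 x = U x.
  move=> xF; apply/idP/idP => [/orP[/asboolP[x' [x'F Ux' x'x]]|]|Ux].
  - by move: x'x => /orP[/eqP<-//|]; apply: top_zeros_up.
  - move=> /asboolP[gx [w [wx gw]]]; have [] := wbP x _; first by exists w.
    rewrite -gwb// => wbx gwbx; apply/asboolP; rewrite gF0//; split=> //.
    by exists (wb x).
  - by apply/orP; left; apply/asboolP; exists x; rewrite lecxx.
have U_0 h : top_zeros h 0 = false.
  by apply/asboolPn => -[_ [w []]]; rewrite ltc_0.
have U0_0 : U0 0 = false.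
  rewrite /U0 U_0 orbF; apply/asboolPn => -[x' [_ Ux']].
  by rewrite lec_0 => /eqP e; rewrite e /U U_0 in Ux'.
have [||||//|m [mm m0 mt _]] := @lift_through tau (lift_at g U) id [::] tauU.
- by rewrite /lift_at /U U_0 g_0.
- apply: lift_at_mono; first exact: top_zeros_up.
  exact: top_zeros_mono.
- by [].
- by [].
have [||||x xF|m' [mm' m'0 m't m'm]] :=
  @lift_through tau (lift_at g0 U0) m F0 tauU.
- by rewrite /lift_at U0_0 g00.
- apply: lift_at_mono => // x y xy; rewrite negb_or => /andP[_].
  exact: top_zeros_mono.
- by [].
- by [].
- by rewrite mt /lift_at U0U// gF0.
exists m, m'; split=> //.
- by move=> x xF; rewrite m'm.
- move=> x; rewrite mt /lift_at; case: ifPn => //= /asboolP[].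
  by [].
- by move=> x; rewrite m't /lift_at; case: ifPn => //= /U0zero.
Qed.

(** A violation involves at most three points, so failing to be an arc map is an open condition. *)
Lemma not_arc_map_witness (g0 : rat -> rat) : ~ arc_map g0 ->
  exists F : seq rat, forall g, {in F, g =1 g0} -> ~ arc_map g.
Proof.
move=> na; apply: contrapT => h; apply: na; split.
  move=> x y xy gy; apply: contrapT => n; apply: h; exists [:: x; y].
  move=> g gF [g1 _]; apply: n.
  by rewrite -!gF ?inE ?eqxx ?orbT//; apply: g1; rewrite // gF ?inE ?eqxx ?orbT.
move=> w x y wx xy gw gx; apply: contrapT => n; apply: h.
exists [:: w; x; y] => g gF [_ g2]; apply: n.
rewrite -gF ?inE ?eqxx ?orbT//.
by apply: g2 wx xy _ _; rewrite gF ?inE ?eqxx ?orbT.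
Qed.

Lemma circ_shift v : circ_preserving (fun x => x + v).
Proof. by move=> x y z; rewrite /circ !lerD2r. Qed.

Lemma Pol3_circ_coincide n (f : operation rat n) : Pol3 circ f ->
  forall a b c : 'I_n -> rat,
  (forall i, coincide (a i) (b i) (c i)) -> coincide (f a) (f b) (f c).
Proof.
move=> fc a b c abc; apply/circ_coincideP.
by split; apply: fc => i; have /circ_coincideP[] := abc i.
Qed.

Lemma near_eval (A : choiceType) n (f0 : operation A n) (x : 'I_n -> A) :
  \forall f \near f0, f x = f0 x.
Proof.
pose ev (f : operation A n) : discrete_topology A := f x.
have : continuous ev by exact: proj_continuous.
by move=> /(_ f0) /(_ [set f0 x]); apply.
Qed.

Lemma near_all_seq (T : topologicalType) (t : T) (I : eqType) (s : seq I)
    (R : I -> T -> Prop) : (forall i, \forall u \near t, R i u) ->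
  \forall u \near t, {in s, forall i, R i u}.
Proof.
move=> h; elim: s => [|i s IH]; first by apply: filterE => u j; rewrite in_nil.
near=> u => j; rewrite inE => /orP[/eqP->|js]; first by near: u; exact: h.
by move: j js; near: u; exact: IH.
Unshelve. all: by end_near. Qed.

Lemma near_box n (f0 : operation rat n) (F : seq rat) :
  \forall f \near f0, forall x, (forall i, x i \in F) -> f x = f0 x.
Proof.
have H : \forall f \near f0, forall k : {ffun 'I_n -> 'I_(size F)},
    f (fun i => nth 0 F (k i)) = f0 (fun i => nth 0 F (k i)).
  apply: (@filter_forall _ {ffun 'I_n -> 'I_(size F)}
    (fun k => [set f : operation rat n |
       f (fun i => nth 0 F (k i)) = f0 (fun i => nth 0 F (k i))])
    _ (nbhs_filter f0)) => k.
  exact: near_eval.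
apply: filterS H => f H x xF.
have lt i : (index (x i) F < size F)%N by rewrite index_mem.
have := H [ffun i => Ordinal (lt i)]; congr (f _ = f0 _);
  by apply/funext => i; rewrite ffunE /= nth_index.
Qed.

(** * Action of the clone on a countable set *)

Lemma mono0_circ m : mono0 m -> circ_preserving m.
Proof.
move=> mm; apply: (@fold_circ (fun x => Some (m x))) => x y /mm.
exact: ltcW.
Qed.

Lemma automorphism_circ g g' : automorphism g g' -> circ_preserving g.
Proof. by case=> _ _ /mono0_circ. Qed.

Definition no_args (T : Type) (i : 'I_0) : T :=
  False_rect T (Bool.diff_false_true (ltn_ord i)).

Lemma no_argsE (T : Type) (x : 'I_0 -> T) : x = no_args T.
Proof. by apply/funext => -[]. Qed.

Definition unary_op (g : rat -> rat) : operation rat 1 := fun x => g (x ord0).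

Definition eventually_const (Y : Type) (u : nat -> Y) (y : Y) : Prop :=
  exists N, forall k, (N <= k)%N -> u k = y.

Definition initial (T : countType) (k : nat) : seq T :=
  pmap unpickle (iota 0 k).

Lemma mem_initial (T : countType) (x : T) k :
  (pickle x < k)%N -> x \in initial T k.
Proof.
move=> h; rewrite /initial mem_pmap; apply/mapP; exists (pickle x).
  by rewrite mem_iota.
by rewrite pickleK.
Qed.

Section Action.
Variables (Omega : countType) (P : operations rat) (Q : operations Omega).
Arguments P n _ : clear implicits.
Arguments Q n _ : clear implicits.
(** The isomorphism as a total function on operations, which avoids dependent types; the hypotheses
    constrain it on [P]. *)
Variable act : forall n, operation rat n -> operation Omega n.
Hypothesis P_circ : forall n f, Pol3 circ f -> P n f.
Hypothesis act_Q : forall n f, P n f -> Q n (act f).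
Hypothesis act_onto : forall n h, Q n h -> exists2 f, P n f & act f = h.
Hypothesis act_inj : forall n (f g : operation rat n),
  P n f -> P n g -> act f = act g -> f = g.
Hypothesis act_proj : forall n (i : 'I_n),
  act (projection rat i) = projection Omega i.
Hypothesis act_comp : forall n m (f : operation rat n)
  (g : 'I_n -> operation rat m), P n f -> (forall i, P m (g i)) ->
  act (composition f g) = composition (act f) (fun i => act (g i)).
Hypothesis Q_closed : forall n (f_ : nat -> operation Omega n)
  (h : operation Omega n), (forall k, Q n (f_ k)) ->
  (forall w, eventually_const (fun k => f_ k w) (h w)) -> Q n h.

Definition act1 (g : rat -> rat) (w : Omega) : Omega :=
  act (unary_op g) (fun=> w).

(** Nullary constants give a copy of the rationals in [Omega], on which [act f] computes [f]. *)
Definition point_of (q : rat) : Omega :=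
  act (n := 0) (fun=> q) (no_args Omega).

Lemma P_const n q : P n (fun=> q).
Proof. by apply: P_circ => a b c _; apply: circ_xx. Qed.

Lemma P_unary g : circ_preserving g -> P 1 (unary_op g).
Proof. by move=> gc; apply: P_circ => a b c h; apply: gc; apply: h. Qed.

Lemma P_proj n (i : 'I_n) : P n (projection rat i).
Proof. by apply: P_circ => a b c; apply. Qed.

Lemma act_unary n (f : operation rat n) g w : circ_preserving g -> P n f ->
  act (fun x => g (f x)) w = act1 g (act f w).
Proof.
move=> gc fP; pose c : 'I_1 -> operation rat n := fun=> f.
by have /(congr1 (@^~ w)) := act_comp (g := c) (P_unary gc) (fun=> fP).
Qed.

Lemma act_coord n (i : 'I_n) g w : circ_preserving g ->
  act (n := n) (fun x => g (x i)) w = act1 g (w i).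
Proof.
move=> gc; rewrite (act_unary (f := projection rat i) w gc (P_proj i)).
by rewrite act_proj.
Qed.

Lemma act1_comp g h w : circ_preserving g -> circ_preserving h ->
  act1 (g \o h) w = act1 g (act1 h w).
Proof.
move=> gc hc.
by rewrite {1}/act1 (act_unary (f := unary_op h) _ gc (P_unary hc)).
Qed.

Lemma act1_id w : act1 id w = w.
Proof. by rewrite /act1 (act_proj ord0). Qed.

Lemma act_const n q w : act (n := n) (fun=> q) w = point_of q.
Proof.
pose c : 'I_0 -> operation rat n := fun i => no_args (operation rat n) i.
have := act_comp (f := fun=> q) (P_const 0 q) (fun i => no_args (P n (c i)) i).
move=> /(congr1 (@^~ w)) /= ->; rewrite /composition /point_of; congr (act _ _).
exact: no_argsE.
Qed.

Lemma act_point_of n (f : operation rat n) (x : 'I_n -> rat) : P n f ->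
  act f (fun i => point_of (x i)) = point_of (f x).
Proof.
move=> fP; pose c : 'I_n -> operation rat 0 := fun i => fun=> x i.
have := act_comp (g := c) fP (fun i => P_const 0 (x i)).
by move=> /(congr1 (@^~ (no_args Omega))).
Qed.

Lemma act1_point_of g q : circ_preserving g -> act1 g (point_of q) =
  point_of (g q).
Proof.
move=> gc; rewrite /act1.
by rewrite (act_point_of (f := unary_op g) (fun=> q) (P_unary gc)).
Qed.

Lemma point_of_inj : injective point_of.
Proof.
move=> p q e.
have : act (n := 0) (fun=> p) = act (n := 0) (fun=> q).
  by apply/funext => w; rewrite (no_argsE w).
move=> /(act_inj (P_const 0 p) (P_const 0 q)).
by move=> /(congr1 (@^~ (no_args rat))).
Qed.

(* Pointwise limits are taken in the closed clone [Q]; the values on the copy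
   of the rationals in [Omega] identify the preimage of the limit. *)
Lemma act1_limit (g_ : nat -> rat -> rat) (g : rat -> rat) :
  (forall k, circ_preserving (g_ k)) -> circ_preserving g ->
  (forall x, eventually_const (fun k => g_ k x) (g x)) ->
  (forall w, exists y, eventually_const (fun k => act1 (g_ k) w) y) ->
  forall w, eventually_const (fun k => act1 (g_ k) w) (act1 g w).
Proof.
move=> g_c gc g_g /choice[h hP].
pose h1 : operation Omega 1 := fun w => h (w ord0).
have Qh : Q 1 h1.
  apply: (Q_closed (f_ := fun k => act (unary_op (g_ k)))).
    by move=> k; apply/act_Q/P_unary.
  move=> w; have [N NP] := hP (w ord0); exists N => k /NP.
  rewrite /act1 /h1 => <-; congr (act _ _).
  by apply/funext => i; rewrite ord1.
have [f fP fh] := act_onto Qh.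
have fg : f = unary_op g.
  apply/funext => x; apply: point_of_inj.
  rewrite -(act_point_of x fP) fh /h1.
  have [N NP] := hP (point_of (x ord0)); have [M MP] := g_g (x ord0).
  rewrite -(NP (maxn N M)) ?leq_maxl// act1_point_of//.
  by rewrite MP ?leq_maxr.
by move=> w; rewrite /act1 -fg fh; apply: hP.
Qed.

(* A Baire category argument: the countably many possible values at [ws]
   cannot all be taken on nowhere dense sets of automorphisms. *)
Lemma automorphism_approximation (ws : seq Omega) : exists F : seq rat,
  forall h h', automorphism h h' -> {in F, forall x, h x = x} ->
  forall E : seq rat, exists u u', [/\ automorphism u u',
    {in ws, forall w, act1 u w = w} & {in E, u =1 h}].
Proof.
apply: contrapT => noF.
pose near_ (s t : (rat -> rat) * (rat -> rat)) (F : seq rat) :=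
  {in F, s.1 =1 t.1} /\ {in F, s.2 =1 t.2}.
pose aut s := @automorphism s.1 s.2.
pose val (s : (rat -> rat) * (rat -> rat)) := map (act1 s.1) ws.
have avoid v s F : aut s -> exists t F1, [/\ aut t, near_ t s F,
    {subset F <= F1} & forall r, aut r -> near_ r t F1 -> val r <> v].
  move=> sA; apply: contrapT => no; apply: noF.
  have [[k [kA ks kv]]|nk] := pselect (exists k, [/\ aut k, near_ k s F
      & val k = v]); last first.
    exfalso; apply: no; exists s, F; split=> // r rA rs rv.
    by apply: nk; exists r.
  have [kK k'K _] := kA.
  (* Fixing [F] and [k.2] of it keeps [k.1 \o h] and its inverse near [s]. An [r] close to
     [k.1 \o h] with value [v] would make [k.2 \o r.1] fix [ws] and agree with [h] on [E]. *)
  exists (F ++ map k.2 F) => h h' hA hF E; apply: contrapT => nou.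
  apply: no; exists (k.1 \o h, h' \o k.2), (F ++ E).
  have [hK h'K _] := hA.
  split.
  - exact: automorphism_comp.
  - split=> x xF /=.
      by rewrite hF ?mem_cat ?xF//; apply: ks.1.
    rewrite -(ks.2 _ xF); apply: (can_inj hK).
    by rewrite h'K hF// mem_cat map_f ?orbT.
  - by move=> x xF; rewrite mem_cat xF.
  move=> r rA [r1 r2] rv; apply: nou.
  exists (k.2 \o r.1), (r.2 \o k.1); split.
  - by apply: automorphism_comp => //; apply: automorphism_inv.
  - move=> w ww; rewrite act1_comp; last 2 first.
    + exact: automorphism_circ (automorphism_inv kA).
    + exact: automorphism_circ rA.
    have -> : act1 r.1 w = act1 k.1 w.
      by have /eq_in_map := etrans rv (esym kv); apply.
    rewrite -act1_comp; last 2 first.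
    + exact: automorphism_circ (automorphism_inv kA).
    + exact: automorphism_circ kA.
    by rewrite (_ : _ \o _ = id) ?act1_id//; apply/funext => x; apply: kK.
  - by move=> x xE; rewrite /= r1 ?mem_cat ?xE ?orbT//= kK.
(* Conditions are an automorphism with a finite set on which it and its inverse are frozen; stage
   [n] freezes the first rationals and excludes the value coded by [n]. *)
pose S := (((rat -> rat) * (rat -> rat)) * seq rat)%type.
pose R n (s t : S) := [/\ near_ t.1 s.1 s.2, {subset s.2 <= t.2},
  {subset initial rat n <= t.2} &
  forall v, unpickle n = Some v -> forall r, aut r -> near_ r t.1 t.2 ->
    val r <> v].
have [|n s sA|u [u0 uP]] :=
    @dependent_choice S (fun _ s => aut s.1) R ((id, id), [::]).
- exact: automorphism_id.
- have [t [F1 [tA ts sF tv]]] := avoid (odflt [::] (unpickle n)) s.1 s.2 sA.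
  exists (t, F1 ++ initial rat n); split=> //; split=> //=.
  + by move=> x /sF; rewrite mem_cat => ->.
  + by move=> x; rewrite mem_cat orbC => ->.
  + move=> v nv r rA [r1 r2]; rewrite nv /= in tv; apply: tv => //.
    by split=> x xF; [apply: r1|apply: r2]; rewrite mem_cat xF.
have nearu n k : near_ (u (n + k)%N).1 (u n).1 (u n).2 /\
    {subset (u n).2 <= (u (n + k)%N).2}.
  elim: k => [|k [[IH1 IH2] IH3]]; first by rewrite addn0; split=> //; split.
  rewrite addnS; have [_ [[h1 h2] h3 _ _]] := uP (n + k)%N.
  split; last by move=> x /IH3 /h3.
  by split=> x xn; [rewrite h1 ?IH1|rewrite h2 ?IH2]; rewrite ?IH3.
(* [x] first belongs to [initial] at index [(pickle x).+1], which is frozen one stage later. *)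
pose st (x : rat) := u (pickle x).+2.
have stF x : x \in (st x).2.
  have [_ [_ _ + _]] := uP (pickle x).+1; apply.
  exact: mem_initial.
pose g x := (st x).1.1 x; pose g' x := (st x).1.2 x.
have gE x n : x \in (u n).2 -> (u n).1.1 x = g x /\ (u n).1.2 x = g' x.
  move=> xn; have [[e1 e2] _] := nearu n (pickle x).+2.
  have [[e3 e4] _] := nearu (pickle x).+2 n.
  by rewrite -e1 -?e2// addnC /g /g' -/(st x) e3 ?e4// stF.
have late x n : (pickle x < n)%N -> x \in (u n.+1).2.
  by move=> xn; have [_ [_ _ + _]] := uP n; apply; apply: mem_initial.
have gA : automorphism g g'.
  split=> [x|x|x y].
  - pose n := (maxn (pickle x) (pickle (g x))).+1.
    have [e1 _] := gE x n.+1 (late x n (leq_maxl _ _)).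
    have [_ e2] := gE (g x) n.+1 (late (g x) n (leq_maxr _ _)).
    by rewrite -e2 -e1; have [[+ _ _] _] := uP n.+1; apply.
  - pose n := (maxn (pickle x) (pickle (g' x))).+1.
    have [_ e1] := gE x n.+1 (late x n (leq_maxl _ _)).
    have [e2 _] := gE (g' x) n.+1 (late (g' x) n (leq_maxr _ _)).
    by rewrite -e2 -e1; have [[_ + _] _] := uP n.+1; apply.
  - pose n := (maxn (pickle x) (pickle y)).+1.
    have [e1 _] := gE x n.+1 (late x n (leq_maxl _ _)).
    have [e2 _] := gE y n.+1 (late y n (leq_maxr _ _)).
    by rewrite -e2 -e1; have [[_ _ +] _] := uP n.+1; apply.
(* The value of the limit automorphism has a code, and was excluded at that stage. *)
have [_ [_ _ _ /(_ _ (pickleK (val (g, g'))) (g, g') gA)]] :=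
  uP (pickle (val (g, g'))).
by apply=> //; split=> x /gE[].
Qed.

(** Write [g] as [p \o r] with [r] fixing a growing finite set. At each stage [r] is approximated by
    some [u] acting trivially on [w] and the first points of [Omega], and [u] is moved from [r] into
    [p]. The maps [p] tend to [g], their actions stabilize, and each fixes [w]. *)
Lemma automorphism_support (w : Omega) : exists F : seq rat,
  forall g g', automorphism g g' -> {in F, forall x, g x = x} -> act1 g w = w.
Proof.
have /choice[D DP] := automorphism_approximation.
pose ws n := w :: initial Omega n.
pose K n := D (ws n) ++ initial rat n.
exists (K 0%N) => g g' gA gF.
pose S := (((rat -> rat) * (rat -> rat)) * ((rat -> rat) * (rat -> rat)))%type.
pose I n (s : S) := [/\ automorphism s.1.1 s.1.2, automorphism s.2.1 s.2.2,
  forall x, s.1.1 (s.2.1 x) = g x & {in K n, forall x, s.2.1 x = x}].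
pose R n (s t : S) := {in ws n, forall w, act1 t.1.1 w = act1 s.1.1 w}.
have [|n [[p p'] [r r']] [/= pA rA pr rK]|s [s0 sP]] :=
    @dependent_choice S I R ((id, id), (g, g')).
- by split=> //=; apply: automorphism_id.
- have [|u [u' [uA uw ur]]] := DP (ws n) r r' rA _ (K n.+1).
    by move=> x xD; apply: rK; rewrite mem_cat xD.
  have [uK u'K _] := uA.
  exists ((p \o u, u' \o p'), (u' \o r, r' \o u)); split.
    split=> /=.
    + exact: automorphism_comp.
    + by apply: automorphism_comp => //; apply: automorphism_inv.
    + by move=> x; rewrite u'K.
    + by move=> x xK; rewrite -ur// uK.
  move=> v vw /=; rewrite act1_comp ?uw//.
    exact: automorphism_circ pA.
  exact: automorphism_circ uA.
have stable v n k : v \in ws n ->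
    act1 (s (n + k)%N).1.1 v = act1 (s n).1.1 v.
  move=> vn; elim: k => [|k IH]; first by rewrite addn0.
  rewrite addnS -IH; have [_ +] := sP (n + k)%N; apply.
  move: vn; rewrite /ws !inE => /orP[->//|]; rewrite /initial iotaD pmap_cat.
  by rewrite mem_cat => ->; rewrite orbT.
have [||x|v|N NP] := @act1_limit (fun n => (s n).1.1) g _ _ _ _ w.
- by move=> k; have [[/automorphism_circ]] := sP k.
- exact: automorphism_circ gA.
- exists (pickle x).+1 => k kx; have [[_ _ e sK] _] := sP k.
  by rewrite -e sK// mem_cat mem_initial ?orbT.
- exists (act1 (s (pickle v).+1).1.1 v), (pickle v).+1 => k kv.
  by rewrite -(subnKC kv) stable// inE mem_initial ?orbT.
rewrite -(NP N (leqnn _)) -[N]add0n stable ?mem_head// s0 /=.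
exact: act1_id.
Qed.

(** An embedding fixing 0 is a limit of automorphisms; their actions at a point stabilize once they
    agree on its support. *)
Lemma embedding_support (w : Omega) : exists F : seq rat, forall m m',
  mono0 m -> m 0 = 0 -> mono0 m' -> m' 0 = 0 -> {in F, m =1 m'} ->
  act1 m w = act1 m' w.
Proof.
have /choice[D DP] := automorphism_support.
have same v g g' h h' : automorphism g g' -> automorphism h h' ->
    {in D v, g =1 h} -> act1 g v = act1 h v.
  move=> gA hA gh; have [hK h'K _] := hA.
  have {1}-> : g = h \o (h' \o g) by apply/funext => x /=; rewrite h'K.
  have cA := automorphism_comp (automorphism_inv hA) gA.
  rewrite act1_comp; last 2 first.
  - exact: automorphism_circ hA.
  - exact: automorphism_circ cA.
  by congr act1; apply: DP cA _ => x xD /=; rewrite gh.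
exists (D w).
have approx m : mono0 m -> m 0 = 0 -> exists g g', [/\ automorphism g g',
    {in D w, g =1 m} & act1 g w = act1 m w].
  move=> mm m0.
  have /choice[g /choice[g' gP]] : forall k, exists g g',
      automorphism g g' /\ {in D w ++ initial rat k, g =1 m}.
    by move=> k; apply: automorphism_extension.
  have [||x|v|N NP] := @act1_limit g m _ _ _ _ w.
  - by move=> k; have [/automorphism_circ] := gP k.
  - exact: mono0_circ.
  - exists (pickle x).+1 => k kx; have [_ ->//] := gP k.
    by rewrite mem_cat mem_initial ?orbT.
  - pose N := (\max_(x <- D v) pickle x).+1.
    exists (act1 (g N) v), N => k Nk.
    apply: same (gP k).1 (gP N).1 _ => x xD.
    have xN : (pickle x < N)%N by rewrite ltnS; apply: leq_bigmax_seq.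
    have [_ -> ] := gP k; last first.
      by rewrite mem_cat mem_initial ?orbT// (leq_trans xN).
    by have [_ ->//] := gP N; rewrite mem_cat mem_initial ?orbT.
  exists (g N), (g' N); have [gA gm] := gP N; split=> //; last exact: NP.
  by move=> x xD; apply: gm; rewrite mem_cat xD.
move=> m m' mm m0 mm' m'0 mF.
have [g [g' [gA gm <-]]] := approx m mm m0.
have [h [h' [hA hm <-]]] := approx m' mm' m'0.
by apply: same gA hA _ => x xD; rewrite gm// hm// mF.
Qed.

Lemma arc_support (w : Omega) (g0 : rat -> rat) : arc_map g0 -> g0 0 = 0 ->
  exists F : seq rat, forall g, arc_map g -> g 0 = 0 -> {in F, g =1 g0} ->
  act1 g w = act1 g0 w.
Proof.
move=> a0 g00; have [tau tauU] := universal_lift_exists.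
have [F0 F0P] := embedding_support w.
have [F FP] := common_lift F0 tauU a0 g00.
exists F => g ag g_0 gF.
have [m [m' [[mm m0] [mm' m'0] mF gm g0m']]] := FP g ag g_0 gF.
have tc : circ_preserving (fold \o tau) by apply: fold_circ; case: tauU.
have -> : g = (fold \o tau) \o m by apply/funext.
have -> : g0 = (fold \o tau) \o m' by apply/funext.
rewrite (act1_comp w tc (mono0_circ mm)) (act1_comp w tc (mono0_circ mm')).
by rewrite (F0P m m').
Qed.

(** Translation by [g0 0] reduces to maps fixing 0. If the translated [g0] is not an arc map,
    neither are its neighbours, so every [circ]-preserving one is two-valued. *)
Lemma unary_support (w : Omega) (g0 : rat -> rat) : circ_preserving g0 ->
  exists F : seq rat, forall g, circ_preserving g -> ~ two_valued g ->
  {in F, g =1 g0} -> act1 g w = act1 g0 w.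
Proof.
move=> gc0; pose v := g0 0; pose sh (g : rat -> rat) x := g x - v.
have shc g : circ_preserving g -> circ_preserving (sh g).
  by move=> gc x y z /gc; apply: circ_shift.
have shK g : circ_preserving g ->
    act1 g w = act1 (fun x => x + v) (act1 (sh g) w).
  move=> gc; rewrite -act1_comp; [|exact: circ_shift|exact: shc].
  by congr act1; apply/funext => x; rewrite /= /sh subrK.
have shtv g : ~ two_valued g -> ~ two_valued (sh g).
  move=> ntv tv; apply: ntv => x y z.
  have := tv x y z; rewrite /sh.
  by case=> /addIr ->; [constructor 1|constructor 2|constructor 3].
have sh0 : sh g0 0 = 0 by rewrite /sh subrr.
have arc g : circ_preserving g -> ~ two_valued g -> g 0 = g0 0 ->
    arc_map (sh g).
  move=> gc /shtv ntv e; apply: circ_preserving_arc => //; first exact: shc.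
  by rewrite /sh e subrr.
have [a0|na0] := pselect (arc_map (sh g0)).
  have [F FP] := arc_support w a0 sh0.
  exists (0 :: F) => g gc ntv gF.
  have e : g 0 = g0 0 by apply: gF; rewrite mem_head.
  rewrite (shK g)// (shK g0)//; congr act1; apply: FP.
  - exact: arc.
  - by rewrite /sh e subrr.
  - by move=> x xF; rewrite /sh gF// inE xF orbT.
have [F FP] := not_arc_map_witness na0.
exists (0 :: F) => g gc ntv gF; exfalso.
have e : g 0 = g0 0 by apply: gF; rewrite mem_head.
apply: (FP (sh g)); last exact: arc.
by move=> x xF; rewrite /sh gF// inE xF orbT.
Qed.

(** * Two-valued operations *)

Lemma two_valued_P n (f : operation rat n) : two_valued f -> P n f.
Proof. by move=> tv; apply: P_circ => a b c _; apply: circ_coincide. Qed.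

Lemma two_valued_circ g : two_valued g -> circ_preserving g.
Proof. by move=> tv x y z _; apply: circ_coincide. Qed.

Definition indicator n (A : ('I_n -> rat) -> bool) : operation rat n :=
  fun x => (A x)%:R.

Lemma two_valued_bool (T : Type) (A : T -> bool) (k : bool -> rat) :
  two_valued (fun x => k (A x)).
Proof.
by move=> x y z; case: (A x) (A y) (A z) => [] [] [];
  solve [constructor 1; done|constructor 2; done|constructor 3; done].
Qed.

Definition bool_op (b : bool -> bool -> bool) : operation rat 2 :=
  fun y => (b (y ord0 == 1) (y ord_max == 1))%:R.

Lemma act_indicator_op n (w : 'I_n -> Omega) (b : bool -> bool -> bool) A B :
  act (indicator (fun x => b (A x) (B x))) w =
  act (bool_op b) (fun i : 'I_2 =>
    if i == ord0 then act (indicator A) w else act (indicator B) w).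
Proof.
pose c (i : 'I_2) := if i == ord0 then indicator A else indicator B.
have bP : P 2 (bool_op b).
  by apply: two_valued_P; apply: (two_valued_bool _ (fun t : bool => t%:R)).
have cP i : P n (c i).
  apply: two_valued_P; rewrite /c; case: ifP => _;
    exact: (two_valued_bool _ (fun t : bool => t%:R)).
have -> : indicator (fun x => b (A x) (B x)) = composition (bool_op b) c.
  apply/funext => x; rewrite /composition /bool_op /c /indicator /=.
  by case: (A x); case: (B x); rewrite ?eqxx // eq_sym oner_eq0.
rewrite act_comp// /composition; congr (act _ _); apply/funext => i.
by rewrite /c; case: ifP.
Qed.

(** Boolean connectives are themselves operations of the clone, so having the same action at [w] is
    a congruence of the power set algebra. *)
Lemma act_indicator_congr n (w : 'I_n -> Omega) (b : bool -> bool -> bool)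
    A A' B B' :
  act (indicator A) w = act (indicator A') w ->
  act (indicator B) w = act (indicator B') w ->
  act (indicator (fun x => b (A x) (B x))) w =
  act (indicator (fun x => b (A' x) (B' x))) w.
Proof.
move=> eA eB.
by rewrite (act_indicator_op w b A B) (act_indicator_op w b A' B') eA eB.
Qed.

(* A colour-swapping automorphism fixing [F] identifies the values of the two
   complementary colour classes off [F], so both of them are null. *)
Lemma complement_null (v : Omega) (F : seq rat) : 0 \in F ->
  (forall g g', automorphism g g' -> {in F, forall x, g x = x} ->
    act1 g v = v) ->
  act1 (fun t => (t \notin F)%:R) v = point_of 0.
Proof.
move=> F0 Fv; have [g [g' [gA gF gc]]] := automorphism_color_swap F0.
pose one : 'I_1 -> Omega := fun=> v.
pose e (B : rat -> bool) :=
  act (indicator (fun x : 'I_1 -> rat => B (x ord0))) one.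
have eE B : e B = act1 (fun t => (B t)%:R) v by [].
have e_op b A A' B B' : e A = e A' -> e B = e B' ->
    e (fun t => b (A t) (B t)) = e (fun t => b (A' t) (B' t)).
  exact: (@act_indicator_congr 1 one b (fun x => A (x ord0))
    (fun x => A' (x ord0)) (fun x => B (x ord0)) (fun x => B' (x ord0))).
pose B t := (t \notin F) && odd_fraction t.
pose B' t := (t \notin F) && ~~ odd_fraction t.
have tvc (A : rat -> bool) : circ_preserving (fun t => (A t)%:R).
  by apply: two_valued_circ; apply: (two_valued_bool _ (fun t : bool => t%:R)).
have BB' : e B = e B'.
  rewrite !eE -{1}(Fv g g' gA gF) -act1_comp; last 2 first.
  - exact: tvc.
  - exact: automorphism_circ gA.
  congr act1; apply/funext => t /=; congr (nat_of_bool _)%:R; rewrite /B /B'.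
  have [tF|tF] := boolP (t \in F); first by rewrite gF// tF.
  by have [-> ->] := gc t tF.
pose N (t : rat) := false.
(* Replacing one factor of [B && B] by the equivalent and disjoint [B'] gives the empty set. *)
have BN : e B = e N.
  have -> : e B = e (fun t => B t && B t).
    by congr e; apply/funext => t; rewrite andbb.
  have -> : e N = e (fun t => B' t && B t).
    congr e; apply/funext => t; rewrite /N /B /B'.
    by case: (t \in F); case: odd_fraction.
  exact: (e_op andb).
have -> : act1 (fun t => (t \notin F)%:R) v = e (fun t => B t || B' t).
  rewrite eE; congr act1; apply/funext => t; congr (nat_of_bool _)%:R.
  by rewrite /B /B'; case: (t \in F); case: odd_fraction.
transitivity (e (fun t => N t || N t)).
  by apply: (e_op orb) => //; rewrite -BB'.
exact: act_const.
Qed.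

(** With [F] containing the supports of all coordinates of [w], the tuples with an entry off [F]
    form a finite union of null sets, so only the trace on the box over [F] matters. *)
Lemma indicator_support n (w : 'I_n -> Omega) : exists F : seq rat,
  forall A A', (forall x, (forall i, x i \in F) -> A x = A' x) ->
  act (indicator A) w = act (indicator A') w.
Proof.
have /choice[D DP] := automorphism_support.
pose F := 0 :: flatten [seq D (w i) | i <- enum 'I_n].
have DF i : {subset D (w i) <= F}.
  move=> x xD; rewrite inE; apply/orP; right; apply/flatten_mapP.
  by exists i; rewrite ?mem_enum.
have null i : act (indicator (fun x => x i \notin F)) w =
    act (indicator (fun=> false)) w.
  rewrite (@act_coord n i (fun t => (t \notin F)%:R)); last first.
    exact/two_valued_circ/(two_valued_bool _ (fun t : bool => t%:R)).
  rewrite complement_null ?mem_head//; first by rewrite act_const.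
  by move=> g g' gA gF; apply: DP gA _ => x /DF /gF.
pose N (x : 'I_n -> rat) := has (fun i => x i \notin F) (enum 'I_n).
have nullN : act (indicator N) w = act (indicator (fun=> false)) w.
  rewrite /N; elim: (enum 'I_n) => [//|i s IH] /=.
  exact: (@act_indicator_congr n w orb _ (fun=> false) _ (fun=> false)).
exists F => A A' AA'.
have restr B : act (indicator B) w =
    act (indicator (fun x => B x && ~~ N x)) w.
  transitivity (act (indicator (fun x => B x && ~~ false)) w).
    by congr (act _ w); apply/funext => x; rewrite /indicator andbT.
  apply/esym; exact: (@act_indicator_congr n w (fun a b => a && ~~ b)).
rewrite restr [RHS]restr; congr (act _ w); apply/funext => x.
rewrite /indicator; have [|] := boolP (N x); first by rewrite !andbF.
move=> /hasPn xF; rewrite AA'// => i.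
by have := xF i; rewrite mem_enum negbK => ->.
Qed.

(** Near [f0] both operations are written as one unary [k] after indicators, which agree on a finite
    box. *)
Lemma two_valued_near n (f0 : operation rat n) (w : 'I_n -> Omega) :
  two_valued f0 -> \forall f \near f0, two_valued f -> act f w = act f0 w.
Proof.
move=> tv0; have [F FP] := indicator_support w.
pose x0 : 'I_n -> rat := fun=> 0; pose p := f0 x0.
have [x1 x1P] : exists x1, (exists x, f0 x <> p) -> f0 x1 <> p.
  by have [[x1]|n1] := pselect (exists x, f0 x <> p); [exists x1|exists x0].
have nF := near_box f0 F.
have n0 := near_eval f0 x0; have n1 := near_eval f0 x1.
apply: filterS3 nF n0 n1 => f fF f_0 f_1 tv.
suff [k [fk f0k]] : exists k : rat -> rat,
    (forall x, f x = k (f x == p)%:R) /\ (forall x, f0 x = k (f0 x == p)%:R).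
  have [k' k'c [fk' f0k']] : exists2 k', circ_preserving k' &
      (forall x, f x = k' (f x == p)%:R) /\
      (forall x, f0 x = k' (f0 x == p)%:R).
    exists (fun t => if t == 1 then k 1 else k 0).
      exact/two_valued_circ/(two_valued_bool _
        (fun b : bool => if b then k 1 else k 0)).
    by split=> x; [rewrite {1}fk|rewrite {1}f0k]; case: (_ == p);
      rewrite ?eqxx // eq_sym oner_eq0.
  pose A x := f x == p; pose A0 x := f0 x == p.
  have tvi (B : ('I_n -> rat) -> bool) : P n (indicator B).
    by apply: two_valued_P; apply: (two_valued_bool _ (fun t : bool => t%:R)).
  have -> : f = fun x => k' (indicator A x) by apply/funext.
  have -> : f0 = fun x => k' (indicator A0 x) by apply/funext.
  rewrite (act_unary w k'c (tvi A)) (act_unary w k'c (tvi A0)).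
  congr act1; apply: FP => x xF.
  by rewrite /A /A0 fF.
have tvE (h : operation rat n) q x : two_valued h -> h x0 = p ->
    h x1 <> p -> h x1 = q -> h x = if h x == p then p else q.
  move=> tvh h0 h1 <-; case: eqP => // hx.
  by case: (tvh x x1 x0); congruence.
have [nc|c] := pselect (exists x, f0 x <> p).
  have f01 := x1P nc.
  exists (fun t => if t == 1 then p else f0 x1); split=> x.
    rewrite {1}(tvE f (f0 x1) x)//; last by rewrite f_1.
    by case: (_ == p); rewrite ?eqxx // eq_sym oner_eq0.
  rewrite {1}(tvE f0 (f0 x1) x)//.
  by case: (_ == p); rewrite ?eqxx // eq_sym oner_eq0.
(* If [f0] is constant, the second value of [k] is borrowed from [f]. *)
have f0p x : f0 x = p by apply: contrapT => ne; apply: c; exists x.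
have [x2 x2P] : exists x2, (exists x, f x <> p) -> f x2 <> p.
  by have [[x2]|n2] := pselect (exists x, f x <> p); [exists x2|exists x0].
exists (fun t => if t == 1 then p else f x2); split=> x; last first.
  by rewrite f0p !eqxx.
have [->|/eqP ne] := eqVneq (f x) p; first by rewrite eqxx.
rewrite eq_sym oner_eq0; have f2 : f x2 <> p by apply: x2P; exists x.
by case: (tv x x2 x0); congruence.
Qed.

(** Finitely many kinds of neighbours arise: two-valued ones, and those depending on a given
    coordinate. If [f0] is not of a given kind, finitely many values keep neighbours from being
    so. *)
Lemma circ_near n (f0 : operation rat n) (w : 'I_n -> Omega) :
  Pol3 circ f0 ->
  \forall f \near f0, Pol3 circ f -> act f w = act f0 w.
Proof.
move=> fc0.
have near2 : \forall f \near f0, two_valued f -> act f w = act f0 w.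
  have [|ntv] := pselect (two_valued f0); first exact: two_valued_near.
  have [x [y [z xyz]]] : exists x y z, ~ coincide (f0 x) (f0 y) (f0 z).
    apply: contrapT => h; apply: ntv => x y z; apply: contrapT => h'.
    by apply: h; exists x, y, z.
  apply: filterS3 (near_eval f0 x) (near_eval f0 y) (near_eval f0 z).
  by move=> f ex ey ez tv; exfalso; apply: xyz; rewrite -ex -ey -ez.
have near1 i : \forall f \near f0, Pol3 circ f -> ~ two_valued f ->
    (forall u v, u i = v i -> f u = f v) -> act f w = act f0 w.
  have [un|nun] := pselect (forall u v, u i = v i -> f0 u = f0 v); last first.
    have [u [v uv fuv]] : exists u, exists2 v,
        u i = v i & f0 u <> f0 v.
      apply: contrapT => h; apply: nun => u v uv; apply: contrapT => h'.
      by apply: h; exists u, v.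
    apply: filterS2 (near_eval f0 u) (near_eval f0 v) => f eu ev _ _ uf.
    by exfalso; apply: fuv; rewrite -eu -ev; apply: uf.
  pose diag (f : operation rat n) (t : rat) := f (fun=> t).
  have diagE f : (forall u v, u i = v i -> f u = f v) ->
      f = fun x => diag f (x i).
    by move=> uf; apply/funext => x; apply: uf.
  have diagc f : Pol3 circ f -> circ_preserving (diag f).
    by move=> fc x y z h; apply: fc => _.
  have [F FP] := unary_support (w i) (diagc f0 fc0).
  have nF : \forall f \near f0, {in F, diag f =1 diag f0}.
    by apply: near_all_seq => t; apply: near_eval.
  apply: filterS nF => f fF fc ntv uf.
  rewrite (diagE f uf) (diagE f0 un) (act_coord i w (diagc f fc)).
  rewrite (act_coord i w (diagc f0 fc0)).
  apply: FP => //; first exact: diagc.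
  move=> tv; apply: ntv => x y z.
  by rewrite (diagE f uf); apply: tv.
have near1' : \forall f \near f0, forall i, Pol3 circ f -> ~ two_valued f ->
    (forall u v, u i = v i -> f u = f v) -> act f w = act f0 w.
  exact: (@filter_forall _ 'I_n (fun i => [set f : operation rat n |
    Pol3 circ f -> ~ two_valued f ->
    (forall u v, u i = v i -> f u = f v) -> act f w = act f0 w])
    _ (nbhs_filter f0)).
apply: filterS2 near2 near1' => f tvf unf fc.
have [tv|ntv] := pselect (two_valued f); first exact: tvf.
have [//|[i ui]] := two_valued_or_unary (Pol3_circ_coincide fc).
exact: unf ui.
Qed.

End Action.

(** * Topology of the clones *)

Lemma cvg_operation (A : choiceType) n (F : set_system (operation A n))
    (f : operation A n) : Filter F ->
  (forall x, \forall g \near F, g x = f x) -> F --> f.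
Proof.
move=> FF Ff; apply/cvg_sup => x.
apply/cvg_image; first by rewrite eqEsubset; split=> // v _; exists (fun=> v).
move=> W /= fW; exists ((fun g : operation A n => g x) @^-1` W).
  by apply: filterS (Ff x) => g /= ->; exact: nbhs_singleton fW.
rewrite eqEsubset; split=> [v [g ? <-]//|v Wv].
by exists (fun=> v).
Qed.

Lemma closed_operations_limit (A : choiceType) (C : operations A) n
    (f_ : nat -> operation A n) (f : operation A n) :
  closed_operations C -> (forall k, C n (f_ k)) ->
  (forall x, eventually_const (fun k => f_ k x) (f x)) -> C n f.
Proof.
move=> cC Cf fx.
have : (fun k => existT (operation A) n (f_ k)) @ \oo -->
    (existT (operation A) n f : all_operations A).
  apply: (@cvg_comp _ _ _ f_ (existT (operation A) n) _ (nbhs f)).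
    apply: cvg_operation => x; have [N NP] := fx x.
    by exists N => // k /= /NP.
  exact: existT_continuous.
move=> cvgf; have near_C : \forall k \near \oo,
    [set f : all_operations A | C (projT1 f) (projT2 f)]
      (existT (operation A) n (f_ k)).
  by apply: nearW => k; apply: Cf.
exact: (@closed_cvg _ _ _ _ _ _ cC near_C _ cvgf).
Qed.

(** A topological sum is treated one arity at a time, and continuity of a map into operations
    follows from local constancy of every evaluation. *)
Lemma clone_map_continuous (A B : choiceType) (C : operations A)
    (D : operations B) (h : forall n, set_type (C n) -> set_type (D n)) :
  (forall n (p : set_type (C n)) (x : 'I_n -> B),
     \forall f \near (set_val p : operation A n),
     forall q : set_type (C n), set_val q = f ->
       set_val (h n q) x = set_val (h n p) x) ->
  continuous (clone_map h).
Proof.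
move=> hloc; have ch n : continuous (h n).
  move=> p; apply: (@continuous_comp_initial _ _ _ _ (h n)) p => p.
  apply: cvg_operation => [|x]; first by apply: fmap_filter; apply: nbhs_filter.
  have := @initial_continuous _ _ (@set_val _ (C n)) p _ (hloc n p x).
  by apply: (@filterS _ _ (nbhs_filter p)) => q /(_ q erefl).
by move=> [n p] U nU; apply: (ch n p _ nU).
Qed.

(* The last hypothesis lets a clone larger than [Pol3 circ] inherit continuity
   from [Pol3 circ]. *)
Lemma clone_isomorphism_homeomorphism (P : operations rat) :
  is_clone P -> (forall n f, Pol3 circ f -> P n f) ->
  (forall (Omega : countType)
      (act : forall n, operation rat n -> operation Omega n) n
      (f0 : operation rat n) (w : 'I_n -> Omega),
    (forall g x, P 1%N (unary_op g) -> P n x ->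
      act n (fun y => g (x y)) w = act 1%N (unary_op g) (fun=> act n x w)) ->
    (forall f1 : operation rat n, Pol3 circ f1 ->
      \forall f \near f1, Pol3 circ f -> act n f w = act n f1 w) ->
    P n f0 -> \forall f \near f0, P n f -> act n f w = act n f0 w) ->
  automatic_homeomorphicity P.
Proof.
move=> [Pproj Pcomp] Pcirc Pnear Omega Q theta Qclone Qclosed.
move=> [[thinv thK thinvK] thproj thcomp].
have Pc n q : P n (fun=> q) by apply: Pcirc => a b c _; apply: circ_xx.
pose mk n f (H : P n f) : set_type (P n) := exist _ f (mem_set H).
(* The image of a nullary constant shows that [Omega] is inhabited; it serves as default outside
   [P]. *)
pose d : Omega := set_val (theta 0%N (mk 0%N _ (Pc 0%N 0))) (no_args Omega).
pose act n (f : operation rat n) : operation Omega n :=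
  if pselect (P n f) is left H then set_val (theta n (mk n f H)) else fun=> d.
have actE n (p : set_type (P n)) : act n (set_val p) = set_val (theta n p).
  rewrite /act; case: pselect => [H|[]]; last exact: set_valP.
  by congr (set_val (theta n _)); apply: val_inj.
have actH n f (H : P n f) : act n f = set_val (theta n (mk n f H)).
  exact: (actE n (mk n f H)).
have th_inj n : injective (theta n).
  move=> p q e; apply: (@existT_inj2 _ (fun n => set_type (P n))).
  by apply: (can_inj thK); rewrite /clone_map /= e.
have th_onto n (q : set_type (Q n)) : exists p, theta n p = q.
  have := thinvK (existT _ n q); case: (thinv _) => m p.
  rewrite /clone_map /= => e; have mn : m = n by exact: existT_inj1 e.
  subst m; exists p; exact: (@existT_inj2 _ (fun n => set_type (Q n))) e.
have act_Q n f : P n f -> Q n (act n f).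
  by move=> H; rewrite (actH n f H); apply: set_valP.
have act_onto n h : Q n h -> exists2 f, P n f & act n f = h.
  move=> H; have [p pq] := th_onto n (exist _ h (mem_set H)).
  by exists (set_val p); [exact: set_valP|rewrite actE pq].
have act_inj n (f g : operation rat n) : P n f -> P n g ->
    act n f = act n g -> f = g.
  move=> Hf Hg; rewrite (actH n f Hf) (actH n g Hg) => /val_inj /th_inj.
  by move=> /(congr1 set_val).
have act_proj n (i : 'I_n) : act n (projection rat i) = projection Omega i.
  by rewrite (actH _ _ (Pproj n i)); apply: thproj.
have act_comp n m (f : operation rat n) (g : 'I_n -> operation rat m) :
    P n f -> (forall i, P m (g i)) ->
    act m (composition f g) = composition (act n f) (fun i => act m (g i)).
  move=> Hf Hg; have Hc := Pcomp n m f g Hf Hg.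
  rewrite (actH _ _ Hc) (actH _ _ Hf).
  rewrite (thcomp n m (mk n f Hf) (fun i => mk m (g i) (Hg i)))//.
  by congr composition; apply/funext => i; rewrite (actH _ _ (Hg i)).
have Q_closed n f_ h := @closed_operations_limit Omega Q n f_ h Qclosed.
have near_act n (f0 : operation rat n) (w : 'I_n -> Omega) : P n f0 ->
    \forall f \near f0, P n f -> act n f w = act n f0 w.
  apply: (Pnear Omega act) => [g x gP xP|f1 f1c].
    have := act_comp 1%N n (unary_op g) (fun=> x) gP (fun=> xP).
    by move=> /(congr1 (@^~ w)).
  exact: (circ_near Pcirc act_Q act_onto act_inj act_proj act_comp
    Q_closed w f1c).
have pointE := act_point_of Pcirc act_comp.
have point_injective := point_of_inj Pcirc act_inj.
split.
  apply: clone_map_continuous => n p x.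
  apply: filterS (near_act n (set_val p) x (set_valP p)) => f fact q qf.
  by rewrite -!actE qf; apply: fact; rewrite -qf; apply: set_valP.
pose psi n (q : set_type (Q n)) := projT1 (cid (th_onto n q)).
have psiP n q : theta n (psi n q) = q by exact: projT2 (cid (th_onto n q)).
have psiK n p : psi n (theta n p) = p by apply: th_inj; rewrite psiP.
exists (clone_map psi); split.
- by move=> [n p]; rewrite /clone_map /= psiK.
- by move=> [n q]; rewrite /clone_map /= psiP.
apply: clone_map_continuous => n p x.
(* The value of the preimage at [x] is read off on the copy of the rationals, at a single tuple of
   [Omega]. *)
apply: filterS (near_eval (set_val p) (fun i => point_of act (x i))).
move=> f fp q qf.
apply: point_injective.
rewrite -!pointE; try exact: set_valP.
by rewrite !actE !psiP qf.
Qed.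

(** * Passage from circular order to separation *)

Lemma Pol3_circ_unary n (f : operation rat n) :
  Pol3 circ f -> two_valued f \/
  exists i, exists2 g, circ_preserving g & f = (fun x => g (x i)).
Proof.
move=> fc; have [|[i ui]] := two_valued_or_unary (Pol3_circ_coincide fc).
  by left.
right; exists i, (fun t => f (fun=> t)); first by move=> x y z h; apply: fc.
by apply/funext => x; apply: ui.
Qed.

Lemma Pol3_circ_sub_Pol4_sep n (f : operation rat n) :
  Pol3 circ f -> Pol4 sep f.
Proof.
move=> /Pol3_circ_unary[tv a b c d _|[i [g gc ->]] a b c d h].
  by left; split; apply/circ_coincide/tv.
by case: (h i) => -[h1 h2]; [left|right]; split; apply: gc.
Qed.

Lemma Pol4_sep_circ n (f : operation rat n) :
  Pol4 sep f -> Pol3 circ f \/ Pol3 circ ((fun x => - f x) : operation rat n).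
Proof.
move=> fs; have fE (a b c : 'I_n -> rat) :
    (forall i, coincide (a i) (b i) (c i)) -> coincide (f a) (f b) (f c).
  (* With its last argument repeated, [sep] puts the triple in both circular orders, that is, two of
     its points coincide. *)
  move=> abc; have : sep (f a) (f b) (f c) (f c).
    apply: fs => i; left; have := abc i.
    move=> h; split; apply: circ_coincide => //.
    by case: h => ->; [constructor 3|constructor 2|constructor 1].
  by case=> -[h1 h2]; apply: circ_anti.
have [tv|[i ui]] := two_valued_or_unary fE.
  by left=> a b c _; apply/circ_coincide/tv.
pose g t := f (fun=> t).
have fg x : f x = g (x i) by apply: ui.
have [|gc|gc] := @sep_preserving_circ g; first by move=> x y z t h; apply: fs.
  by left=> a b c h; rewrite !fg; apply: gc.
by right=> a b c h /=; rewrite !fg; apply: gc.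
Qed.

Lemma Pol4_sep_opp : Pol4 sep (unary_op -%R).
Proof.
move=> a b c d /(_ ord0); rewrite /unary_op.
by case=> -[h1 h2]; [right|left]; split; apply: circ_opp.
Qed.

Lemma near_opp n (f0 : operation rat n) (R : operation rat n -> Prop) :
  (\forall f \near ((fun x => - f0 x) : operation rat n), R f) ->
  \forall f \near f0, R (fun x => - f x).
Proof.
pose opp (f : operation rat n) : operation rat n := fun x => - f x.
suff : opp @ nbhs f0 --> nbhs (opp f0) by apply.
apply: cvg_operation => x.
by apply: filterS (near_eval f0 x) => f /(congr1 -%R).
Qed.

Lemma near_not_Pol3 (A : choiceType) (R : A -> A -> A -> Prop) n
    (f0 : operation A n) :
  ~ Pol3 R f0 -> \forall f \near f0, ~ Pol3 R f.
Proof.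
move=> nf0; have [a [b [c [abc nR]]]] : exists a b c : 'I_n -> A,
    (forall i, R (a i) (b i) (c i)) /\ ~ R (f0 a) (f0 b) (f0 c).
  apply: contrapT => h; apply: nf0 => a b c abc; apply: contrapT => nR.
  by apply: h; exists a, b, c.
apply: filterS3 (near_eval f0 a) (near_eval f0 b) (near_eval f0 c).
by move=> f ea eb ec fR; apply: nR; rewrite -ea -eb -ec; apply: fR.
Qed.

Theorem theorem5p2 :
  automatic_homeomorphicity (Pol3 circ) /\
  automatic_homeomorphicity (Pol4 sep).
Proof.
split; apply: clone_isomorphism_homeomorphism.
- exact: Pol3_clone.
- by [].
- by move=> Omega act n f0 w _ + fc; apply.
- exact: Pol4_clone.
- exact: Pol3_circ_sub_Pol4_sep.
move=> Omega act n f0 w act_comp circ_near_ fs.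
pose opp (f : operation rat n) : operation rat n := fun x => - f x.
(* If [f0] does not preserve [circ], a failing triple persists nearby and the claim is vacuous. *)
have near1 : \forall f \near f0, Pol3 circ f -> act n f w = act n f0 w.
  have [/circ_near_//|/near_not_Pol3] := pselect (Pol3 circ f0).
  by apply: filterS => f nf /nf.
have near2 : \forall f \near f0, Pol3 circ (opp f) ->
    act n (opp f) w = act n (opp f0) w.
  apply: (near_opp (R := fun f => Pol3 circ f -> act n f w = act n (opp f0) w)).
  have [/circ_near_//|/near_not_Pol3] := pselect (Pol3 circ (opp f0)).
  by apply: filterS => f nf /nf.
have oppP f : Pol4 sep f -> Pol4 sep (opp f).
  by move=> fP a b c d h; apply: (Pol4_sep_opp (a := fun=> f a) (b := fun=> f b)
    (c := fun=> f c) (d := fun=> f d)) => _; apply: fP.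
(* Negation lies in the clone, so the action of [f] is recovered from that of [opp f]. *)
have actE f : Pol4 sep f ->
    act n f w = act 1%N (unary_op -%R) (fun=> act n (opp f) w).
  move=> /oppP fP; rewrite -(act_comp _ _ Pol4_sep_opp fP); congr (act n _ w).
  by apply/funext => x; rewrite /opp opprK.
apply: filterS2 near1 near2 => f n1 n2 fP.
have [/n1//|fo] := Pol4_sep_circ fP.
by rewrite (actE f fP) (actE f0 fs) n2.
Qed.
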